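(* Let $\mu^B\colon\mathbb B\to\mathbb A$ and $\mu^C\colon\mathbb C\to\mathbb A$ be immersions of graphs of groups with $\mathbb B$ and $\mathbb C$ connected, and let $\mathbb D=\mathbb B\,\widetilde\times_{\mathbb A}\,\mathbb C$ be their $\mathbb A$-product. Fix vertices $u_0\in V(\mathsf A)$, $v_0\in V(\mathsf B)$, $w_0\in V(\mathsf C)$ with $\mu^B(v_0)=\mu^C(w_0)=u_0$ and let $A=\pi_1(\mathbb A,u_0)$, $B=\mu^B_*(\pi_1(\mathbb B,v_0))$, $C=\mu^C_*(\pi_1(\mathbb C,w_0))$. For each $v\in V(\mathsf B)$ fix a $\mathbb B$-path $p_v$ from $v_0$ to $v$, and for each $w\in V(\mathsf C)$ a $\mathbb C$-path $q_w$ from $w_0$ to $w$. Then the map $$V(\mathsf D)\to B\backslash A/C,\qquad V_{v,w}\ni \mu^B(B_v)\,a\,\mu^C(C_w)\longmapsto B\,\bigl(\mu^B(p_v)\,a\,\mu^C(q_w)^{-1}\bigr)\,C$$ induces a bijection from the set of connected components of $\mathrm{core}(\mathbb D)$ to the set of double cosets $\{BgC : g\in A,\ B^g\cap C \text{ is not locally elliptic}\}$.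
   Context: **Conventions.** For group elements, $x^g=g^{-1}xg$, $B^g=g^{-1}Bg$ and $\gamma_g(x)=x^g$. A graph $\mathsf A$ has a vertex set $V(\mathsf A)$, an edge set $E(\mathsf A)$, maps $o,t\colon E(\mathsf A)\to V(\mathsf A)$ and a fixed-point-free involution $e\mapsto e^{-1}$ on edges with $t(e^{-1})=o(e)$; graph morphisms preserve this structure. **Graphs of groups.** A graph of groups $\mathbb A$ consists of a graph $\mathsf A$, vertex groups $A_u$, edge groups $A_e=A_{e^{-1}}$, and monomorphisms $\alpha_e\colon A_e\to A_{o(e)}$, $\omega_e\colon A_e\to A_{t(e)}$ with $\omega_e=\alpha_{e^{-1}}$. It is connected if $\mathsf A$ is. **Paths.** An $\mathbb A$-path of length $k$ is a sequence $p=(a_0,e_1,a_1,\dots,e_k,a_k)$ where $(e_1,\dots,e_k)$ is a path in $\mathsf A$, $a_{i-1}\in A_{o(e_i)}$, $a_k\in A_{t(e_k)}$ (for $k=0$: $p=(a)$ with $a$ in a vertex group). Paths are concatenated by multiplying the adjacent group elements; $p^{-1}=(a_k^{-1},e_k^{-1},\dots,e_1^{-1},a_0^{-1})$; a circuit is a path with equal ends. The congruence $=_{\mathbb A}$ is generated by $(1,e,\omega_e(x),e^{-1},1)=_{\mathbb A}(\alpha_e(x))$, $x\in A_e$. The quotient of the category of $\mathbb A$-paths by $=_{\mathbb A}$ is the fundamental groupoid $\pi_1(\mathbb A)$; $\pi_1(\mathbb A,u)$ is the group of classes of circuits at $u$. A path is reduced if $a_i\notin\omega_{e_i}(A_{e_i})$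 whenever $e_{i+1}=e_i^{-1}$; a circuit is cyclically reduced if it is reduced and, when $e_k=e_1^{-1}$, also $a_ka_0\notin\alpha_{e_1}(A_{e_1})$. **Core, local ellipticity.** $\mathrm{core}(\mathbb A)$ is the graph of groups consisting of all vertices and edges of $\mathsf A$ (with the corresponding groups and maps) occurring in cyclically reduced $\mathbb A$-circuits of positive length. A subgroup $H\le\pi_1(\mathbb A,u)$ is locally elliptic if for each $h\in H$ there is an $\mathbb A$-path $p$ starting at $u$ with $p^{-1}hp\in A_{t(p)}$ in $\pi_1(\mathbb A)$. **Morphisms.** A morphism $\mu\colon\mathbb B\to\mathbb A$ consists of a graph morphism $\mathsf B\to\mathsf A$ (also written $\mu$), monomorphisms $\mu_v\colon B_v\to A_{\mu(v)}$ and $\mu_f\colon B_f\to A_{\mu(f)}$, and, for each edge $f$ of $\mathsf B$, twisting elements $f_\alpha\in A_{\mu(o(f))}$, $f_\omega\in A_{\mu(t(f))}$ with $(f^{-1})_\alpha=f_\omega$ and $(f^{-1})_\omega=f_\alpha$, such that with $e=\mu(f)$, $v=o(f)$, $v'=t(f)$: $\alpha_e\circ\mu_f=\gamma_{f_\alpha}\circ\mu_v\circ\alpha_f$ and $\omega_e\circ\mu_f=\gamma_{f_\omega}\circ\mu_{v'}\circ\omega_f$. (We often omit subscripts on $\mu$.) It acts on paths by $\mu(b_0,f_1,b_1,\dots,f_k,b_k)=(\mu(b_0)(f_1)_\alpha,\mu(f_1),(f_1)_\omega^{-1}\mu(b_1)(f_2)_\alpha,\dots,\mu(f_k),(f_k)_\omega^{-1}\mu(b_k))$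 and induces $\mu_*\colon\pi_1(\mathbb B,v)\to\pi_1(\mathbb A,\mu(v))$. **Immersions.** $\mu$ is an immersion if (i) for edges $f,f'$ of $\mathsf B$ with common origin $v$ and common image $e$, $f=f'$ if and only if $\mu_v(B_v)f_\alpha\alpha_e(A_e)=\mu_v(B_v)f'_\alpha\alpha_e(A_e)$; and (ii) for every edge $f$ with $v=o(f)$, $e=\mu(f)$: $\alpha_e(\mu_f(B_f))=\mu_v(B_v)^{f_\alpha}\cap\alpha_e(A_e)$. **The $\mathbb A$-product.** Given $\mu^B\colon\mathbb B\to\mathbb A$, $\mu^C\colon\mathbb C\to\mathbb A$, the $\mathbb A$-product $\mathbb D=\mathbb B\,\widetilde\times_{\mathbb A}\,\mathbb C$ is defined as follows. For vertices $v,w$ with $\mu^B(v)=\mu^C(w)=u$ let $V_{v,w}$ be the set of double cosets $\mu^B(B_v)\,a\,\mu^C(C_w)$, $a\in A_u$; for edges $f,g$ with $\mu^B(f)=\mu^C(g)=e$ let $E_{f,g}$ be the set of double cosets $\mu^B(B_f)\,a\,\mu^C(C_g)$, $a\in A_e$. Then $V(\mathsf D)=\bigsqcup V_{v,w}$, $E(\mathsf D)=\bigsqcup E_{f,g}$; the inverse of $h\in E_{f,g}$ is the same double coset viewed in $E_{f^{-1},g^{-1}}$; and the edge $\mu^B(B_f)\,a\,\mu^C(C_g)$ has origin $\mu^B(B_{o(f)})\,(f_\alpha\alpha_e(a)g_\alpha^{-1})\,\mu^C(C_{o(g)})$ and terminus $\mu^B(B_{t(f)})\,(f_\omega\omega_e(a)g_\omega^{-1})\,\mu^C(C_{t(g)})$.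 Fix representatives $\tilde x\in x$ and $\tilde h=\widetilde{h^{-1}}\in h$ of the double cosets, and for each $h\in E_{f,g}$ with $o(h)=x\in V_{v,w}$ fix $b_h\in B_v$, $c_h\in C_w$ with $\tilde x=\mu^B(b_h)f_\alpha\alpha_e(\tilde h)g_\alpha^{-1}\mu^C(c_h)^{-1}$. Put $D_x=\{(b,c)\in B_v\times C_w:\tilde x^{-1}\mu^B(b)\tilde x=\mu^C(c)\}$, $D_h=\{(b,c)\in B_f\times C_g:\tilde h^{-1}\mu^B(b)\tilde h=\mu^C(c)\}$, $\alpha_h(b,c)=(b_h\alpha_f(b)b_h^{-1},\,c_h\alpha_g(c)c_h^{-1})$, $\omega_h=\alpha_{h^{-1}}$. Different choices of representatives give isomorphic results. *)

(* Defs.v *)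
From HB Require Import structures.
From mathcomp Require Import all_boot.
From mathcomp Require Import boolp classical_sets functions.

Set Implicit Arguments.
Unset Strict Implicit.
Unset Printing Implicit Defensive.

Local Open Scope group_scope.
Local Open Scope classical_set_scope.
Local Open Scope quotient_scope.

Notation "{ 'ghom' G -> H }" := (UMagmaMorphism.type G%type H%type)
  (at level 0, G at level 98, H at level 99,
   format "{ 'ghom'  G  ->  H }") : type_scope.

Definition dcoset (G : groupType) (H K : set G) (a : G) : set G :=
  [set h * a * k | h in H & k in K].

Definition conj_set (G : groupType) (H : set G) (g : G) : set G :=
  [set h ^ g | h in H].

(* Edges are indexed by their end points: [edge u v] is the set of the edges e
   with o(e) = u and t(e) = v, so that [einv] exchanges the end points by
   typing. Only a loop can be typed as equal to its inverse, hence [einv_neq]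
   is the fixed-point-freeness of the involution. *)
Record graph := Graph {
  vert :> Type;
  edge : vert -> vert -> Type;
  einv : forall u v, edge u v -> edge v u;
  einvK : forall u v (e : edge u v), einv (einv e) = e;
  einv_neq : forall u (e : edge u u), einv e <> e
}.
Arguments edge {g} u v.
Arguments einv {g u v} e.

Definition tot_edge (G : graph) := {u : G & {v : G & edge u v}}.

(* An edge packed with its end points, to compare edges of different types. *)
Definition tot (G : graph) (u v : G) (e : edge u v) : tot_edge G :=
  existT _ u (existT _ v e).

Lemma tot_einv_neq (G : graph) (u v : G) (e : edge u v) :
  tot (einv e) <> tot e.
Proof.
move=> E; have uv := f_equal (@projT1 _ _) E; move: E; rewrite /= in uv.
case: u / uv e => e E; apply: (einv_neq (e := e)).
have := projT2_eq E; rewrite (Prop_irrelevance (projT1_eq E) erefl) /= => E'.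
have := projT2_eq E'; by rewrite (Prop_irrelevance (projT1_eq E') erefl).
Qed.

Inductive gconn (G : graph) (x : G) : G -> Prop :=
| gconn_refl : gconn x x
| gconn_step y z : gconn x y -> edge y z -> gconn x z.

Definition connected (G : graph) : Prop := forall x y : G, gconn x y.

Definition component (G : graph) (x : G) : set G := [set y | gconn x y].

Definition components (G : graph) : set (set G) := range (@component G).
Arguments components G _ : clear implicits.

(* The equality A_e = A_{e^-1} is rendered by an isomorphism [eflip] from A_e
   to A_{e^-1}; omega_e is alpha_{e^-1} read through it. The field [eflipK] says
   omega_{e^-1} (eflip x) = alpha_e x, i.e., as alpha is injective, that [eflip]
   is involutive modulo (e^-1)^-1 = e. *)
Record gog := Gog {
  gog_graph :> graph;
  vgrp : gog_graph -> groupType;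
  egrp : forall u v : gog_graph, edge u v -> groupType;
  alpha : forall (u v : gog_graph) (e : edge u v), {ghom egrp e -> vgrp u};
  alpha_inj : forall (u v : gog_graph) (e : edge u v), injective (alpha e);
  eflip : forall (u v : gog_graph) (e : edge u v),
    {ghom egrp e -> egrp (einv e)};
  eflipK : forall (u v : gog_graph) (e : edge u v) (x : egrp e),
    alpha (einv (einv e)) (eflip (einv e) (eflip e x)) = alpha e x
}.
Arguments vgrp {g} u.
Arguments egrp {g u v} e.
Arguments alpha {g u v} e.
Arguments alpha_inj {g u v} e.
Arguments eflip {g u v} e.
Arguments eflipK {g u v} e x.

Definition omega (A : gog) (u v : A) (e : edge u v) : {ghom egrp e -> vgrp v} :=
  alpha (einv e) \o eflip e.
Arguments omega {A u v} e.

Lemma eflip2_cast (A : gog) (u v : A) (e : edge u v) (x : egrp e) :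
  eq_rect _ (fun e => egrp e : Type) (eflip (einv e) (eflip e x)) _ (einvK e) = x.
Proof.
have := eflipK e x; move: (eflip (einv e) _); move: (einvK e).
by move: (einv (einv e)) => e'' q; case: e / q x => x y /= /alpha_inj.
Qed.

Lemma eflip_inj (A : gog) (u v : A) (e : edge u v) : injective (eflip e).
Proof.
by move=> x y /(f_equal (eflip (einv e)))/(f_equal (alpha _));
  rewrite !eflipK => /alpha_inj.
Qed.

Lemma eflip_surj (A : gog) (u v : A) (e : edge u v) (y : egrp (einv e)) :
  exists x, eflip e x = y.
Proof.
exists (eq_rect _ (fun e => egrp e : Type) (eflip (einv e) y) _ (einvK e)).
apply: (@alpha_inj _ _ _ (einv e)); rewrite -[RHS]eflipK.
have castE e' (q : einv (einv e) = e') z :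
    alpha (einv e') (eflip e' (eq_rect _ (fun e => egrp e : Type) z _ q)) =
    alpha (einv (einv (einv e))) (eflip _ z) by case: e' / q.
exact: castE.
Qed.

Inductive gpath (A : gog) : A -> A -> Type :=
| Pnil (u : A) (a : vgrp u) : gpath u u
| Pcons (u v w : A) (a : vgrp u) (e : edge u v) (p : gpath v w) : gpath u w.
Arguments gpath {A} u v.
Arguments Pnil {A u} a.
Arguments Pcons {A u v w} a e p.

HB.instance Definition _ (A : gog) (u v : A) := gen_eqMixin (gpath u v).
HB.instance Definition _ (A : gog) (u v : A) := gen_choiceMixin (gpath u v).

Section Paths.
Variable A : gog.
Implicit Types u v w : A.

Definition plmul u v (a : vgrp u) (p : gpath u v) : gpath u v :=
  match p in gpath u v return vgrp u -> gpath u v with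
  | Pnil _ b => fun a => Pnil (a * b)
  | Pcons _ _ _ b e p => fun a => Pcons (a * b) e p
  end a.

Fixpoint pcat u v w (p : gpath u v) : gpath v w -> gpath u w :=
  match p in gpath u v return gpath v w -> gpath u w with
  | Pnil _ a => fun q => plmul a q
  | Pcons _ _ _ a e p => fun q => Pcons a e (pcat p q)
  end.

Fixpoint pathV u v (p : gpath u v) : gpath v u :=
  match p in gpath u v return gpath v u with
  | Pnil _ a => Pnil a^-1
  | Pcons _ _ _ a e p => pcat (pathV p) (Pcons 1 (einv e) (Pnil a^-1))
  end.

Fixpoint plen u v (p : gpath u v) : nat :=
  if p is Pcons _ _ _ _ _ p then (plen p).+1 else 0.

Inductive peq : forall u v, gpath u v -> gpath u v -> Prop :=
| peq_refl u v (p : gpath u v) : peq p p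
| peq_sym u v (p q : gpath u v) : peq p q -> peq q p
| peq_trans u v (p q r : gpath u v) : peq p q -> peq q r -> peq p r
| peq_cat u v w (p p' : gpath u v) (q q' : gpath v w) :
    peq p p' -> peq q q' -> peq (pcat p q) (pcat p' q')
| peq_edge u v (e : edge u v) (x : egrp e) :
    peq (Pcons 1 e (Pcons (omega e x) (einv e) (Pnil 1))) (Pnil (alpha e x)).

Definition peqb u v (p q : gpath u v) : bool := `[< peq p q >].

Lemma peqb_refl u v : reflexive (@peqb u v).
Proof. by move=> p; apply/asboolP; exact: peq_refl. Qed.

Lemma peqb_sym u v : symmetric (@peqb u v).
Proof.
by move=> p q; apply/asboolP/asboolP; exact: peq_sym.
Qed.

Lemma peqb_trans u v : transitive (@peqb u v).
Proof.
by move=> q p r /asboolP pq /asboolP qr; apply/asboolP; exact: peq_trans qr.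
Qed.

Canonical peqb_equiv u v :=
  EquivRel (@peqb u v) (@peqb_refl u v) (@peqb_sym u v) (@peqb_trans u v).

(* The morphisms from u to v of the fundamental groupoid. *)
Definition groupoid u v := {eq_quot @peqb u v}.
HB.instance Definition _ u v := Choice.on (groupoid u v).

Definition pclass u v (p : gpath u v) : groupoid u v := \pi_(groupoid u v) p.

Definition gmul u v w (x : groupoid u v) (y : groupoid v w) : groupoid u w :=
  pclass (pcat (repr x) (repr y)).

Definition ginv u v (x : groupoid u v) : groupoid v u :=
  pclass (pathV (repr x)).

Lemma pclassP u v (p q : gpath u v) : pclass p = pclass q <-> peq p q.
Proof.
split=> [/eqmodP/asboolP //|pq].
by apply/eqmodP/asboolP.
Qed.

Lemma pclassK u v (x : groupoid u v) : pclass (repr x) = x.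
Proof. exact: reprK. Qed.

Lemma peq_repr u v (p : gpath u v) : peq (repr (pclass p)) p.
Proof. by apply/pclassP; rewrite pclassK. Qed.

Lemma groupoid_ind u v (P : groupoid u v -> Prop) :
  (forall p, P (pclass p)) -> forall x, P x.
Proof. by move=> Pp x; rewrite -[x]pclassK. Qed.

Lemma plmul1 u v (p : gpath u v) : plmul 1 p = p.
Proof. by case: p => [w a|w w' w'' a e p] /=; rewrite mul1g. Qed.

Lemma plmulM u v (a b : vgrp u) (p : gpath u v) :
  plmul a (plmul b p) = plmul (a * b) p.
Proof.
by case: p a b => [w c|w w' w'' c e p] a b /=; rewrite mulgA.
Qed.

Lemma pcat_plmul u v w (a : vgrp u) (p : gpath u v) (q : gpath v w) :
  pcat (plmul a p) q = plmul a (pcat p q).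
Proof. by case: p a q => [x b|x y z b e p] a q //=; rewrite plmulM. Qed.

Lemma pcatA u v w x (p : gpath u v) (q : gpath v w) (r : gpath w x) :
  pcat p (pcat q r) = pcat (pcat p q) r.
Proof.
elim: p w x q r => [y a|y y' y'' a e p IH] w x q r /=.
  by rewrite pcat_plmul.
by rewrite IH.
Qed.

Lemma pcat1 u v (p : gpath u v) : pcat p (Pnil 1) = p.
Proof. by elim: p => [w a|w w' w'' a e p IH] /=; rewrite ?mulg1 ?IH. Qed.

Lemma pcat_pathV u v (p : gpath u v) : peq (pcat p (pathV p)) (Pnil 1).
Proof.
elim: p => [w a|w w' w'' a e p IH] /=.
  by rewrite mulgV; exact: peq_refl.
rewrite pcatA.
have -> : Pcons a e (pcat (pcat p (pathV p)) (Pcons 1 (einv e) (Pnil a^-1))) =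
   pcat (Pcons a e (Pnil 1)) (pcat (pcat p (pathV p)) (Pcons 1 (einv e) (Pnil a^-1))).
  by rewrite /= plmul1.
apply: (@peq_trans _ _ _ (pcat (Pcons a e (Pnil 1))
   (pcat (Pnil 1) (Pcons 1 (einv e) (Pnil a^-1))))).
  by apply: peq_cat; [exact: peq_refl|apply: peq_cat => //; exact: peq_refl].
rewrite /= mul1g mul1g.
have -> : Pcons a e (Pcons 1 (einv e) (Pnil a^-1)) =
   pcat (pcat (Pnil a) (Pcons 1 e (Pcons (omega e 1) (einv e) (Pnil 1)))) (Pnil a^-1).
  by rewrite /= !gmulf1 mulg1 mul1g.
apply: (@peq_trans _ _ _ (pcat (pcat (Pnil a) (Pnil (alpha e 1))) (Pnil a^-1))).
  apply: peq_cat; last exact: peq_refl.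
  by apply: peq_cat; [exact: peq_refl|exact: peq_edge].
by rewrite /= gmulf1 mulg1 mulgV; exact: peq_refl.
Qed.

Lemma pathV_plmul u v (a : vgrp u) (p : gpath u v) :
  pathV (plmul a p) = pcat (pathV p) (Pnil a^-1).
Proof.
case: p a => [w b|w w' w'' b e p] a /=; first by rewrite invgM.
by rewrite -pcatA /= invgM.
Qed.

Lemma pathV_pcat u v w (p : gpath u v) (q : gpath v w) :
  pathV (pcat p q) = pcat (pathV q) (pathV p).
Proof.
elim: p w q => [y a|y y' y'' a e p IH] w q /=; first by rewrite pathV_plmul.
by rewrite IH pcatA.
Qed.

Lemma pathVK u v (p : gpath u v) : pathV (pathV p) = p.
Proof.
elim: p => [y a|y y' y'' a e p IH] /=; first by rewrite invgK.
by rewrite pathV_pcat /= IH einvK invgK invg1 /= mulg1 plmul1.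
Qed.

Lemma pcat_pathVl u v (p : gpath u v) : peq (pcat (pathV p) p) (Pnil 1).
Proof. by have := pcat_pathV (pathV p); rewrite pathVK. Qed.

Lemma peq_pathV u v (p q : gpath u v) : peq p q -> peq (pathV p) (pathV q).
Proof.
move=> pq; apply: (@peq_trans _ _ _ (pcat (pathV p) (pcat q (pathV q)))).
  rewrite -[X in peq X _]pcat1; apply: peq_cat; first exact: peq_refl.
  by apply: peq_sym; exact: pcat_pathV.
rewrite pcatA; apply: (@peq_trans _ _ _ (pcat (pcat (pathV p) p) (pathV q))).
  apply: peq_cat; last exact: peq_refl.
  by apply: peq_cat; [exact: peq_refl|exact: peq_sym].
rewrite -[X in peq _ X]plmul1; apply: (@peq_cat _ _ _ _ (Pnil 1)) => //.
  exact: pcat_pathVl.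
exact: peq_refl.
Qed.

Lemma gmulE u v w (p : gpath u v) (q : gpath v w) :
  gmul (pclass p) (pclass q) = pclass (pcat p q).
Proof. by apply/pclassP; apply: peq_cat; exact: peq_repr. Qed.

Lemma ginvE u v (p : gpath u v) : ginv (pclass p) = pclass (pathV p).
Proof. by apply/pclassP/peq_pathV; exact: peq_repr. Qed.

Definition pi1 u := groupoid u u.
HB.instance Definition _ u := Choice.on (pi1 u).

Definition pi1_one u : pi1 u := pclass (Pnil 1).

Lemma pi1_mulA u : associative (@gmul u u u : pi1 u -> pi1 u -> pi1 u).
Proof.
move=> x y z; elim/groupoid_ind: x => p; elim/groupoid_ind: y => q.
by elim/groupoid_ind: z => r; rewrite !gmulE pcatA.
Qed.

Lemma pi1_mul1 u : left_id (pi1_one u) (@gmul u u u : pi1 u -> pi1 u -> pi1 u).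
Proof. by elim/groupoid_ind => p; rewrite gmulE /= plmul1. Qed.

Lemma pi1_mulr1 u :
  right_id (pi1_one u) (@gmul u u u : pi1 u -> pi1 u -> pi1 u).
Proof. by elim/groupoid_ind => p; rewrite gmulE pcat1. Qed.

Lemma pi1_mulV u : left_inverse (pi1_one u) (@ginv u u : pi1 u -> pi1 u)
  (@gmul u u u : pi1 u -> pi1 u -> pi1 u).
Proof.
elim/groupoid_ind => p; rewrite ginvE gmulE; apply/pclassP.
exact: pcat_pathVl.
Qed.

Lemma pi1_mulrV u : right_inverse (pi1_one u) (@ginv u u : pi1 u -> pi1 u)
  (@gmul u u u : pi1 u -> pi1 u -> pi1 u).
Proof.
elim/groupoid_ind => p; rewrite ginvE gmulE; apply/pclassP.
exact: pcat_pathV.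
Qed.

HB.instance Definition _ u := isGroup.Build (pi1 u) (@pi1_mulA u)
  (@pi1_mul1 u) (@pi1_mulr1 u) (@pi1_mulV u) (@pi1_mulrV u).

End Paths.
Arguments groupoid {A} u v.
Arguments pi1 {A} u.

Section Core.
Variable A : gog.
Implicit Types u v w : A.

Definition pfirst_el u v (p : gpath u v) : vgrp u :=
  match p in gpath u v return vgrp u with
  | Pnil _ a => a
  | Pcons _ _ _ a _ _ => a
  end.

Fixpoint plast_el u v (p : gpath u v) : vgrp v :=
  match p in gpath u v return vgrp v with
  | Pnil _ a => a
  | Pcons _ _ _ _ _ p => plast_el p
  end.

Definition pfirst_edge u v (p : gpath u v) : option (tot_edge A) :=
  if p is Pcons _ _ _ _ e _ then Some (tot e) else None.

Fixpoint plast_edge u v (p : gpath u v) : option (tot_edge A) :=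
  if p is Pcons _ _ _ _ e p then
    if plast_edge p is Some e' then Some e' else Some (tot e)
  else None.

Fixpoint pverts u v (p : gpath u v) : set A :=
  match p with
  | Pnil u _ => [set u]
  | Pcons u _ _ _ _ p => u |` pverts p
  end.

Fixpoint pedges u v (p : gpath u v) : set (tot_edge A) :=
  if p is Pcons _ _ _ _ e p then tot e |` pedges p else set0.

Fixpoint reduced u v (p : gpath u v) : Prop :=
  if p is Pcons _ _ _ _ e p then
    (pfirst_edge p = Some (tot (einv e)) -> ~ range (omega e) (pfirst_el p))
    /\ reduced p
  else True.

Definition cyc_reduced u (p : gpath u u) : Prop :=
  reduced p /\
  forall v (e : edge u v),
    pfirst_edge p = Some (tot e) -> plast_edge p = Some (tot (einv e)) ->
    ~ range (alpha e) (plast_el p * pfirst_el p).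

Definition core_vert (x : A) : Prop :=
  exists u (p : gpath u u), [/\ cyc_reduced p, (0 < plen p)%N & pverts p x].

Definition core_edge x y (e : edge x y) : Prop :=
  exists u (p : gpath u u),
    [/\ cyc_reduced p, (0 < plen p)%N & pedges p (tot e)].

Lemma tot_einv u v (e : edge u v) u' v' (e' : edge u' v') :
  tot e = tot e' -> tot (einv e) = tot (einv e').
Proof.
by move=> ee'; apply: (f_equal
  (fun t : tot_edge A => tot (einv (projT2 (projT2 t)))) ee').
Qed.

Lemma tot_rect u v (e : edge u v) (Q : forall w, edge u w -> Prop) :
  Q v e -> forall w (e' : edge u w), tot e = tot e' -> Q w e'.
Proof.
move=> Qe w e' ee'; have [h] : existT (edge u) v e = existT (edge u) w e'.
  have := projT2_eq ee'; by rewrite (Prop_irrelevance (projT1_eq ee') erefl).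
move=> ?; exact: (@eq_ind _ (existT (edge u) v e)
  (fun t => Q (projT1 t) (projT2 t)) Qe (existT (edge u) w e')).
Qed.

Lemma range_alphaK u v (e : edge u v) a :
  range (alpha (einv e)) a -> range (omega e) a.
Proof.
move=> [x _ <-].
have : range (omega (einv (einv e))) (alpha (einv e) x).
  by exists (eflip (einv e) x) => //; exact: eflipK.
by rewrite einvK.
Qed.

Lemma pfirst_edge_cat u v w (p : gpath u v) b x (e : edge v x) (q : gpath x w) :
  pfirst_edge (pcat p (Pcons b e q)) =
  if pfirst_edge p is Some t then Some t else Some (tot e).
Proof. by case: p b e q. Qed.

Lemma pfirst_el_cat u v w (p : gpath u v) x (e : edge v x) (q : gpath x w) :
  pfirst_el (pcat p (Pcons 1 e q)) = pfirst_el p.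
Proof. by case: p e q => //= y a e q; rewrite mulg1. Qed.

Lemma plast_edge_cat u v w (p : gpath u v) b (e : edge v w) c :
  plast_edge (pcat p (Pcons b e (Pnil c))) = Some (tot e).
Proof. by elim: p w b e c => [y a|y y' y'' a e' p IH] w b e c //=; rewrite IH. Qed.

Lemma plast_el_cat u v w (p : gpath u v) b (e : edge v w) c :
  plast_el (pcat p (Pcons b e (Pnil c))) = c.
Proof. by elim: p w b e c => [y a|y y' y'' a e' p IH] w b e c //=; rewrite IH. Qed.

Lemma reduced_cat u v w (p : gpath u v) (e : edge v w) c :
  reduced p ->
  (forall z (e' : edge v z), plast_edge p = Some (tot (einv e')) ->
     tot e = tot e' -> ~ range (alpha e') (plast_el p)) ->
  reduced (pcat p (Pcons 1 e (Pnil c))).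
Proof.
elim: p w e c => [y a|y y' y'' a e' p IH] w e c //= [ra rp] H; split; last first.
  apply: IH => // z f pf; apply: H; by rewrite pf.
rewrite pfirst_edge_cat pfirst_el_cat.
case: p {IH rp} e' ra e H => [z b|z z' z'' b f p] e' ra e H //= /Some_inj ee' rb.
apply: (H _ (einv e')) => //=; first by rewrite einvK.
by move: rb => [x _ <-]; exists (eflip e' x).
Qed.

Lemma pfirst_edge_pathV u v (p : gpath u v) x y (e : edge x y) :
  pfirst_edge p = Some (tot e) -> plast_edge (pathV p) = Some (tot (einv e)).
Proof.
case: p => [//|w w' w'' a f p] /= /Some_inj E.
by rewrite plast_edge_cat (tot_einv E).
Qed.

Lemma plast_edge_pathV u v (p : gpath u v) x y (e : edge x y) :
  plast_edge (pathV p) = Some (tot e) -> pfirst_edge p = Some (tot (einv e)).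
Proof.
case: p => [//|w w' w'' a f p] /=; rewrite plast_edge_cat => /Some_inj E.
by rewrite -(tot_einv E) einvK.
Qed.

Lemma plast_el_pathV u v (p : gpath u v) : plast_el (pathV p) = (pfirst_el p)^-1.
Proof. by case: p => [//|w w' w'' a e p] /=; rewrite plast_el_cat. Qed.

Lemma pfirst_el_pathV u v (p : gpath u v) : pfirst_el (pathV p) = (plast_el p)^-1.
Proof. by rewrite -[X in plast_el X]pathVK plast_el_pathV invgK. Qed.

Lemma reduced_pathV u v (p : gpath u v) : reduced p -> reduced (pathV p).
Proof.
elim: p => [//|y y' y'' a e p IH] /= [ra rp].
apply: reduced_cat; first exact: IH.
move=> z e' /plast_edge_pathV; rewrite einvK plast_el_pathV => pe' ee'.
have {}ra : ~ range (omega e) (pfirst_el p) by apply: ra; rewrite pe' ee'.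
apply: (@tot_rect _ _ (einv e)
  (fun w f => ~ range (alpha f) (pfirst_el p)^-1)) ee'.
move=> [x _ xp]; apply: ra; apply: range_alphaK.
by exists x^-1 => //; rewrite gmulfV xp invgK.
Qed.

Lemma cyc_reduced_pathV u (p : gpath u u) : cyc_reduced p -> cyc_reduced (pathV p).
Proof.
move=> [rp cp]; split; first exact: reduced_pathV.
move=> v e /pfirst_edge_pathV; rewrite pathVK => pe /plast_edge_pathV.
rewrite einvK => pe'; rewrite plast_el_pathV pfirst_el_pathV -invgM.
move=> [x _ xp]; apply: (cp _ _ pe' pe).
by exists x^-1 => //; rewrite gmulfV xp invgK.
Qed.

Lemma pedges_cat u v w (p : gpath u v) b x (e : edge v x) (q : gpath x w) :
  pedges (pcat p (Pcons b e q)) = pedges p `|` (tot e |` pedges q).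
Proof.
elim: p b x e q => [y a|y y' y'' a e' p IH] b x e q /=; first by rewrite set0U.
by rewrite IH setUA.
Qed.

Lemma pedges_pathV u v (p : gpath u v) x y (e : edge x y) :
  pedges p (tot e) -> pedges (pathV p) (tot (einv e)).
Proof.
elim: p => [//|z z' z'' a e' p IH] /=; rewrite pedges_cat => -[/= E|/IH]; last by left.
by right; left; rewrite /= (tot_einv E).
Qed.

Lemma plen_pcat u v w (p : gpath u v) (q : gpath v w) :
  plen (pcat p q) = (plen p + plen q)%N.
Proof.
by elim: p w q => [y a|y y' y'' a e p IH] w q /=; [case: q a | rewrite IH].
Qed.

Lemma plen_pathV u v (p : gpath u v) : plen (pathV p) = plen p.
Proof.
by elim: p => [//|y y' y'' a e p IH] /=; rewrite plen_pcat IH /= addn1.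
Qed.

Lemma core_edge_einv x y (e : edge x y) : core_edge e -> core_edge (einv e).
Proof.
move=> [u [p [cp p0 pe]]]; exists u, (pathV p); split.
- exact: cyc_reduced_pathV.
- by rewrite plen_pathV.
- exact: pedges_pathV.
Qed.

Definition core_einv (x y : {x : A | core_vert x})
    (e : {e : edge (sval x) (sval y) | core_edge e}) :
    {e : edge (sval y) (sval x) | core_edge e} :=
  exist _ (einv (sval e)) (core_edge_einv (svalP e)).

Lemma core_einvK x y e : @core_einv y x (@core_einv x y e) = e.
Proof. by case: e => e he; apply: eq_exist => /=; rewrite einvK. Qed.

Lemma core_einv_neq x e : @core_einv x x e <> e.
Proof. by move=> /(f_equal sval)/einv_neq. Qed.

Definition core_graph : graph := Graph core_einvK core_einv_neq.

Definition core : gog := @Gog core_graph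
  (fun x => vgrp (sval x))
  (fun x y e => egrp (sval e))
  (fun x y e => alpha (sval e))
  (fun x y e => alpha_inj (sval e))
  (fun x y e => eflip (sval e))
  (fun x y e => eflipK (sval e)).

Definition locally_elliptic u (H : set (pi1 u)) : Prop :=
  forall h, H h -> exists v (p : gpath u v) (a : vgrp v),
    gmul (gmul (ginv (pclass p)) h) (pclass p) = pclass (Pnil a).

End Core.

(* Compatibility of mu_f and mu_{f^-1} with [eflip] is not a field: it follows
   from the two twisting equations, alpha being injective (see [ehom_atV]). *)
Record gmorph (B A : gog) := GMorph {
  vmap :> B -> A;
  emap : forall v v' : B, edge v v' -> edge (vmap v) (vmap v');
  emapV : forall (v v' : B) (f : edge v v'), emap (einv f) = einv (emap f);
  vhom : forall v : B, {ghom vgrp v -> vgrp (vmap v)};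
  vhom_inj : forall v : B, injective (vhom v);
  ehom : forall (v v' : B) (f : edge v v'), {ghom egrp f -> egrp (emap f)};
  ehom_inj : forall (v v' : B) (f : edge v v'), injective (ehom f);
  twa : forall v v' : B, edge v v' -> vgrp (vmap v);
  two : forall v v' : B, edge v v' -> vgrp (vmap v');
  twaV : forall (v v' : B) (f : edge v v'), twa (einv f) = two f;
  twoV : forall (v v' : B) (f : edge v v'), two (einv f) = twa f;
  ehom_alpha : forall (v v' : B) (f : edge v v') (b : egrp f),
    alpha (emap f) (ehom f b) = vhom v (alpha f b) ^ twa f;
  ehom_omega : forall (v v' : B) (f : edge v v') (b : egrp f),
    omega (emap f) (ehom f b) = vhom v' (omega f b) ^ two f
}.
Arguments emap {B A} g {v v'} f.
Arguments vhom {B A} g v.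
Arguments ehom {B A} g {v v'} f.
Arguments twa {B A} g {v v'} f.
Arguments two {B A} g {v v'} f.

Definition immersion (B A : gog) (mu : gmorph B A) : Prop :=
  (forall (v v1 v2 : B) (f : edge v v1) (f' : edge v v2),
     tot (emap mu f) = tot (emap mu f') ->
     (tot f = tot f' <->
      dcoset (range (vhom mu v)) (range (alpha (emap mu f))) (twa mu f) =
      dcoset (range (vhom mu v)) (range (alpha (emap mu f'))) (twa mu f')))
  /\
  (forall (v v' : B) (f : edge v v'),
     [set alpha (emap mu f) (ehom mu f b) | b in setT] =
     conj_set (range (vhom mu v)) (twa mu f) `&` range (alpha (emap mu f))).

Section PathMap.
Variables (B A : gog) (mu : gmorph B A).

Fixpoint pmap (v v' : B) (p : gpath v v') : gpath (mu v) (mu v') :=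
  match p in gpath v v' return gpath (mu v) (mu v') with
  | Pnil v b => Pnil (vhom mu v b)
  | Pcons v _ _ b f p =>
      Pcons (vhom mu v b * twa mu f) (emap mu f) (plmul (two mu f)^-1 (pmap p))
  end.

Lemma pmap_plmul (v v' : B) (b : vgrp v) (p : gpath v v') :
  pmap (plmul b p) = plmul (vhom mu v b) (pmap p).
Proof. by case: p b => [w c|w w' w'' c e p] b /=; rewrite gmulfM ?mulgA. Qed.

Lemma pmap_pcat (v v' v'' : B) (p : gpath v v') (q : gpath v' v'') :
  pmap (pcat p q) = pcat (pmap p) (pmap q).
Proof.
elim: p v'' q => [w b|w w' w'' b f p IH] x q /=; first exact: pmap_plmul.
by rewrite IH pcat_plmul.
Qed.

Lemma pmap_peq (v v' : B) (p q : gpath v v') : peq p q -> peq (pmap p) (pmap q).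
Proof.
elim=> {v v' p q}.
- by move=> *; exact: peq_refl.
- by move=> *; exact: peq_sym.
- by move=> ? ? ? ? ? _ pq _ qr; exact: peq_trans qr.
- by move=> ? ? ? ? ? ? ? _ pp' _ qq'; rewrite !pmap_pcat; exact: peq_cat.
move=> v v' f x /=.
rewrite emapV twaV twoV !gmulf1 mul1g mulg1.
have -> : (two mu f)^-1 * (vhom mu v' (omega f x) * two mu f) =
    omega (emap mu f) (ehom mu f x) by rewrite ehom_omega.
have -> : vhom mu v (alpha f x) =
    twa mu f * alpha (emap mu f) (ehom mu f x) * (twa mu f)^-1.
  by rewrite ehom_alpha /conjg mulVKg mulgK.
set e := emap mu f; set y := ehom mu f x.
have -> : Pcons (twa mu f) e (Pcons (omega e y) (einv e) (Pnil (twa mu f)^-1)) =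
  pcat (pcat (Pnil (twa mu f))
         (Pcons 1 e (Pcons (omega e y) (einv e) (Pnil 1))))
       (Pnil (twa mu f)^-1) by rewrite /= mulg1 mul1g.
apply: (@peq_trans _ _ _ _ (pcat (pcat (Pnil (twa mu f)) (Pnil (alpha e y)))
  (Pnil (twa mu f)^-1))); last exact: peq_refl.
apply: peq_cat; last exact: peq_refl.
by apply: peq_cat; [exact: peq_refl|exact: peq_edge].
Qed.

Definition pi1_map (v : B) (x : pi1 v) : pi1 (mu v) := pclass (pmap (repr x)).

Lemma pi1_mapE (v : B) (p : gpath v v) :
  pi1_map (pclass p) = pclass (pmap p).
Proof. by apply/pclassP/pmap_peq; exact: peq_repr. Qed.

Lemma pi1_map_monoid (v : B) : monoid_morphism (@pi1_map v).
Proof.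
split=> [|x y]; first by rewrite pi1_mapE /= gmulf1.
elim/groupoid_ind: x => p; elim/groupoid_ind: y => q.
have mulE w (r s : gpath w w) :
    (pclass r : pi1 w) * pclass s = pclass (pcat r s) by exact: gmulE.
by rewrite mulE !pi1_mapE mulE pmap_pcat.
Qed.
HB.instance Definition _ (v : B) :=
  isUMagmaMorphism.Build (pi1 v) (pi1 (mu v)) (@pi1_map v) (pi1_map_monoid v).

End PathMap.

(* The components of a morphism [mu], transported along equations [mu v = u]
   and [emap mu f = e]: they map into the groups at u and at e themselves, so
   that images of two morphisms over the same u or e can be compared. *)
Section At.
Variables (B A : gog) (mu : gmorph B A).

Definition vhom_at (v : B) (u : A) (h : mu v = u) : {ghom vgrp v -> vgrp u} :=
  match h in _ = u return {ghom vgrp v -> vgrp u} with erefl => vhom mu v end.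

Definition emap_at (v v' : B) (u u' : A) (h : mu v = u) (h' : mu v' = u')
    (f : edge v v') : edge u u' :=
  match h in _ = u, h' in _ = u' return edge u u' with
  | erefl, erefl => emap mu f
  end.

Definition ehom_emap_at (v v' : B) (u u' : A) (h : mu v = u) (h' : mu v' = u')
    (f : edge v v') : {ghom egrp f -> egrp (emap_at h h' f)} :=
  match h as h in _ = u, h' as h' in _ = u'
    return {ghom egrp f -> egrp (emap_at h h' f)} with
  | erefl, erefl => ehom mu f
  end.

Definition ehom_at (v v' : B) (u u' : A) (h : mu v = u) (h' : mu v' = u')
    (f : edge v v') (e : edge u u') (he : emap_at h h' f = e) :
    {ghom egrp f -> egrp e} :=
  match he in _ = e return {ghom egrp f -> egrp e} with
  | erefl => ehom_emap_at h h' f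
  end.

Definition twa_at (v v' : B) (u : A) (h : mu v = u) (f : edge v v') : vgrp u :=
  match h in _ = u return vgrp u with erefl => twa mu f end.

Definition two_at (v v' : B) (u' : A) (h' : mu v' = u') (f : edge v v') :
    vgrp u' :=
  match h' in _ = u return vgrp u with erefl => two mu f end.

Definition pmap_at (v v' : B) (u u' : A) (h : mu v = u) (h' : mu v' = u')
    (p : gpath v v') : gpath u u' :=
  match h in _ = u, h' in _ = u' return gpath u u' with
  | erefl, erefl => pmap mu p
  end.

Definition pi1_map_at (v : B) (u : A) (h : mu v = u) : {ghom pi1 v -> pi1 u} :=
  match h in _ = u return {ghom pi1 v -> pi1 u} with
  | erefl => pi1_map mu (v:=v)
  end.

Section Edge.
Variables (v v' : B) (u u' : A) (h : mu v = u) (h' : mu v' = u').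
Variables (f : edge v v') (e : edge u u') (he : emap_at h h' f = e).

Lemma vhom_at_inj : injective (vhom_at h).
Proof. by case: u / h; exact: vhom_inj. Qed.

Lemma emap_atV : emap_at h' h (einv f) = einv (emap_at h h' f).
Proof. by case: u / h; case: u' / h' => /=; exact: emapV. Qed.

Lemma emap_atVE : emap_at h' h (einv f) = einv e.
Proof. by rewrite emap_atV he. Qed.

Lemma ehom_at_inj : injective (ehom_at he).
Proof.
by case: e / he; case: u / h; case: u' / h' => /=; exact: ehom_inj.
Qed.

Lemma twa_atV : twa_at h' (einv f) = two_at h' f.
Proof. by case: u' / h'; exact: twaV. Qed.

Lemma two_atV : two_at h (einv f) = twa_at h f.
Proof. by case: u / h; exact: twoV. Qed.

Lemma ehom_at_alpha b :
  alpha e (ehom_at he b) = vhom_at h (alpha f b) ^ twa_at h f.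
Proof.
case: e / he; case: u / h; case: u' / h' => /=; exact: ehom_alpha.
Qed.

Lemma ehom_at_omega b :
  omega e (ehom_at he b) = vhom_at h' (omega f b) ^ two_at h' f.
Proof.
case: e / he; case: u / h; case: u' / h' => /=; exact: ehom_omega.
Qed.
End Edge.

Lemma ehom_atV (v v' : B) (u u' : A) (h : mu v = u) (h' : mu v' = u')
    (f : edge v v') (e : edge u u') (he : emap_at h h' f = e)
    (he' : emap_at h' h (einv f) = einv e) b :
  ehom_at he' (eflip f b) = eflip e (ehom_at he b).
Proof.
apply: (@alpha_inj _ _ _ (einv e)); rewrite ehom_at_alpha.
have := ehom_at_omega he b; rewrite -twa_atV /omega /= => ->.
by [].
Qed.
End At.

Arguments vhom_at {B A} mu {v u} h.
Arguments emap_at {B A} mu {v v' u u'} h h' f.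
Arguments ehom_at {B A} mu {v v' u u' h h' f e} he.
Arguments twa_at {B A} mu {v v' u} h f.
Arguments two_at {B A} mu {v v' u'} h' f.
Arguments pmap_at {B A} mu {v v' u u'} h h' p.
Arguments pi1_map_at {B A} mu {v u} h.

Section Pullback.
Variables (G H K : groupType) (phi : {ghom G -> K}) (psi : {ghom H -> K}).
Variable a : K.

Definition pullback_pred : {pred G * H} :=
  [pred bc | a^-1 * phi bc.1 * a == psi bc.2].

Lemma pullback_group_closed : group_closed pullback_pred.
Proof.
have JE z : a^-1 * z * a = z ^ a by rewrite /conjg mulgA.
split=> [|x y]; rewrite !inE /= !JE ?gmulf1 ?conj1g //.
by move=> /eqP xE /eqP yE; rewrite !gmulfF conjMg conjVg xE yE.
Qed.

Definition pullback := {bc : G * H | bc \in pullback_pred}.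
HB.instance Definition _ := SubChoice.on pullback.
HB.instance Definition _ :=
  SubChoice_isSubGroup.Build (G * H)%type pullback_pred pullback pullback_group_closed.

Lemma pullbackP (x : pullback) : a^-1 * phi (val x).1 * a = psi (val x).2.
Proof. by have := valP x; rewrite inE => /eqP. Qed.
End Pullback.

Section Product.
Variables (A B C : gog) (muB : gmorph B A) (muC : gmorph C A).

(* A vertex of the product over a vertex [pvA] of A: the double coset [pvset]
   in V_{pvB,pvC}. *)
Record pvertex := PVertex {
  pvA : A;
  pvB : B;
  pvC : C;
  pvBA : muB pvB = pvA;
  pvCA : muC pvC = pvA;
  pvset : set (vgrp pvA);
  pvsetP : exists a, pvset =
    dcoset (range (vhom_at muB pvBA)) (range (vhom_at muC pvCA)) a
}.

Arguments pvset : clear implicits.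

(* An edge from x to y over an edge [peA] of A: a double coset [peset] in
   E_{peB,peC} whose origin is x and whose terminus is y. *)
Record pedge (x y : pvertex) := PEdge {
  peA : edge (pvA x) (pvA y);
  peB : edge (pvB x) (pvB y);
  peC : edge (pvC x) (pvC y);
  peBA : emap_at muB (pvBA x) (pvBA y) peB = peA;
  peCA : emap_at muC (pvCA x) (pvCA y) peC = peA;
  peset : set (egrp peA);
  pesetP : exists a, [/\
    peset = dcoset (range (ehom_at muB peBA)) (range (ehom_at muC peCA)) a,
    pvset x =
      dcoset (range (vhom_at muB (pvBA x))) (range (vhom_at muC (pvCA x)))
        (twa_at muB (pvBA x) peB * alpha peA a * (twa_at muC (pvCA x) peC)^-1) &
    pvset y =
      dcoset (range (vhom_at muB (pvBA y))) (range (vhom_at muC (pvCA y)))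
        (two_at muB (pvBA y) peB * omega peA a * (two_at muC (pvCA y) peC)^-1)]
}.

Arguments peset {x y} p.

Lemma pedge_inv_subproof (x y : pvertex) (h : pedge x y) :
  exists a, [/\
    [set eflip (peA h) t | t in peset h] =
      dcoset (range (ehom_at muB (emap_atVE (peBA h))))
             (range (ehom_at muC (emap_atVE (peCA h)))) a,
    pvset y =
      dcoset (range (vhom_at muB (pvBA y))) (range (vhom_at muC (pvCA y)))
        (twa_at muB (pvBA y) (einv (peB h)) * alpha (einv (peA h)) a *
           (twa_at muC (pvCA y) (einv (peC h)))^-1) &
    pvset x =
      dcoset (range (vhom_at muB (pvBA x))) (range (vhom_at muC (pvCA x)))
        (two_at muB (pvBA x) (einv (peB h)) * omega (einv (peA h)) a *
           (two_at muC (pvCA x) (einv (peC h)))^-1)].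
Proof.
have [a [hS hx hy]] := pesetP h; exists (eflip (peA h) a); split.
- rewrite hS; apply/seteqP; split=> z /=.
    move=> [_ [_ [b _ <-]] [_ [c _ <-] <-] <-].
    exists (ehom_at muB (emap_atVE (peBA h)) (eflip (peB h) b)) => //.
    exists (ehom_at muC (emap_atVE (peCA h)) (eflip (peC h) c)) => //.
    by rewrite (ehom_atV (peBA h)) (ehom_atV (peCA h)) !gmulfM.
  move=> [_ [b' _ <-]] [_ [c' _ <-] <-].
  have [b <-] := eflip_surj b'; have [c <-] := eflip_surj c'.
  exists (ehom_at muB (peBA h) b * a * ehom_at muC (peCA h) c).
    by exists (ehom_at muB (peBA h) b) => //; exists (ehom_at muC (peCA h) c).
  by rewrite (ehom_atV (peBA h)) (ehom_atV (peCA h)) !gmulfM.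
- by rewrite !twa_atV hy.
- by rewrite !two_atV hx /= eflipK.
Qed.

Definition pedge_inv (x y : pvertex) (h : pedge x y) : pedge y x :=
  PEdge (pedge_inv_subproof h).

Lemma pedge_eq (x y : pvertex) (h k : pedge x y) (q : peA h = peA k) :
  peB h = peB k -> peC h = peC k ->
  eq_rect _ (fun e => set (egrp e)) (peset h) _ q = peset k -> h = k.
Proof.
case: h q => e f g pf pg S SP; case: k => e' f' g' pf' pg' S' SP' /= q.
case: e' / q pf' pg' S' SP' => pf' pg' S' SP' ff' gg' /= SS'.
case: f' / ff' pf' SP' => pf'; case: g' / gg' pg' => pg'.
case: S' / SS'; rewrite (Prop_irrelevance pf' pf) (Prop_irrelevance pg' pg).
by move=> SP'; rewrite (Prop_irrelevance SP' SP).
Qed.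

Lemma pedge_invK (x y : pvertex) (h : pedge x y) :
  pedge_inv (pedge_inv h) = h.
Proof.
apply: (@pedge_eq _ _ (pedge_inv (pedge_inv h)) h (einvK (peA h)));
  [exact: einvK|exact: einvK|].
have cast_image e e' (q : e' = e) (f : egrp (peA h) -> egrp e') S :
    eq_rect _ (fun e => set (egrp e)) [set f t | t in S] _ q =
    [set eq_rect _ (fun e => egrp e : Type) (f t) _ q | t in S].
  by case: e / q.
rewrite /= image_comp cast_image -[RHS]image_id.
by apply: eq_imagel => t _; exact: eflip2_cast.
Qed.

Lemma pedge_inv_neq (x : pvertex) (h : pedge x x) : pedge_inv h <> h.
Proof. by move=> /(f_equal (@peB x x))/einv_neq. Qed.

Definition pgraph : graph := Graph pedge_invK pedge_inv_neq.

(* The choices of the representatives \tilde x and \tilde h, and of the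
   elements b_h and c_h. *)
Record pchoice := PChoice {
  vrep : forall x : pvertex, vgrp (pvA x);
  vrepP : forall x : pvertex, pvset x (vrep x);
  erep : forall (x y : pvertex) (h : pedge x y), egrp (peA h);
  erepP : forall (x y : pvertex) (h : pedge x y), peset h (erep h);
  erepV : forall (x y : pvertex) (h : pedge x y),
    erep (pedge_inv h) = eflip (peA h) (erep h);
  brep : forall (x y : pvertex) (h : pedge x y), vgrp (pvB x);
  crep : forall (x y : pvertex) (h : pedge x y), vgrp (pvC x);
  vrepE : forall (x y : pvertex) (h : pedge x y),
    vrep x = vhom_at muB (pvBA x) (brep h) *
             twa_at muB (pvBA x) (peB h) * alpha (peA h) (erep h) *
             (twa_at muC (pvCA x) (peC h))^-1 *
             (vhom_at muC (pvCA x) (crep h))^-1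
}.

Lemma pedge_repE (x y : pvertex) (h : pedge x y) a r :
  peset h a -> pvset x r ->
  exists b c, r = vhom_at muB (pvBA x) b * twa_at muB (pvBA x) (peB h) *
    alpha (peA h) a * (twa_at muC (pvCA x) (peC h))^-1 *
    (vhom_at muC (pvCA x) c)^-1.
Proof.
have [a0 [-> -> _]] := pesetP h.
move=> [_ [b1 _ <-] [_ [c1 _ <-] <-]] [_ [b _ <-] [_ [c _ <-] <-]].
exists (b * (alpha (peB h) b1)^-1), (c^-1 * alpha (peC h) c1).
rewrite !gmulfM !gmulfV (ehom_at_alpha (peBA h)) (ehom_at_alpha (peCA h)).
by rewrite /conjg !invgM !invgK !mulgA !(mulgK, mulgVK).
Qed.

Lemma pchoice_inhabited : inhabited pchoice.
Proof.
pose T := {x : pvertex & {y : pvertex & pedge x y}}.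
pose tt (x y : pvertex) (h : pedge x y) : T := existT _ x (existT _ y h).
pose O x y (h : pedge x y) : set T := [set tt x y h; tt y x (pedge_inv h)].
have OV x y (h : pedge x y) : O _ _ (pedge_inv h) = O _ _ h.
  by rewrite /O pedge_invK setUC.
have [c cP] : exists c : set T -> option T,
    forall S t, S t -> exists2 s, c S = Some s & S s.
  have /choice[c cP] : forall S : set T, exists o : option T,
      forall t, S t -> exists2 s, o = Some s & S s.
    move=> S; have [[t St]|nS] := pselect (exists t, S t).
      by exists (Some t) => _ _; exists t.
    by exists None => t St; case: nS; exists t.
  by exists c => S t; exact: cP.
pose pos x y (h : pedge x y) := c (O x y h) = Some (tt x y h).
have posV x y (h : pedge x y) : pos _ _ (pedge_inv h) <-> ~ pos _ _ h.
  rewrite /pos OV; split=> [-> /Some_inj E|npos].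
    apply: (@tot_einv_neq _ _ _ (peB h)).
    exact: (f_equal (fun t : T => tot (peB (projT2 (projT2 t)))) E).
  have [|s sE Os] := cP (O x y h) (tt x y h); first by left.
  by move: Os npos; rewrite sE => -[] -> // /(_ erefl).
have peset_ex x y (h : pedge x y) : exists a, peset h a.
  have [a [-> _ _]] := pesetP h; exists (1 * a * 1).
  by exists 1; [exists 1 => //; rewrite gmulf1|exists 1 => //; exists 1 => //; rewrite gmulf1].
pose rep0 x y (h : pedge x y) := sval (cid (peset_ex x y h)).
have rep0P x y (h : pedge x y) : peset h (rep0 x y h) by exact: svalP.
have repE x y (h : pedge x y) : exists a, peset h a /\
    ((pos x y h -> a = rep0 x y h) /\
     (~ pos x y h -> eflip (peA h) a = rep0 y x (pedge_inv h))).
  have [ph|nph] := pselect (pos x y h); first by exists (rep0 x y h).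
  have [a ha aE] := rep0P _ _ (pedge_inv h).
  by exists a.
pose erep0 x y (h : pedge x y) := sval (cid (repE x y h)).
have erep0P x y (h : pedge x y) := svalP (cid (repE x y h)).
have eflip2_rep0 x y (h : pedge x y) :
    eflip _ (eflip _ (rep0 x y h)) = rep0 x y (pedge_inv (pedge_inv h)).
  apply: (@alpha_inj _ _ _ (einv (einv (peA h)))); rewrite eflipK.
  pose F (k : pedge x y) := alpha (peA k) (rep0 x y k).
  by rewrite -[LHS]/(F h) -[RHS]/(F (pedge_inv (pedge_inv h))) pedge_invK.
have erep0V x y (h : pedge x y) :
    erep0 _ _ (pedge_inv h) = eflip (peA h) (erep0 _ _ h).
  have [_ [hp hn]] := erep0P x y h; have [_ [hp' hn']] := erep0P _ _ (pedge_inv h).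
  have [ph|nph] := pselect (pos x y h).
    apply: (@eflip_inj _ _ _ (einv (peA h))); rewrite [erep0 x y h]hp //.
    by rewrite eflip2_rep0 -hn' // => /posV; apply.
  by rewrite [RHS]hn // [LHS]hp' //; exact/posV.
have vset_ex (x : pvertex) : exists a, pvset x a.
  have [a ->] := pvsetP x; exists (1 * a * 1).
  by exists 1; [exists 1 => //; rewrite gmulf1|exists 1 => //; exists 1 => //; rewrite gmulf1].
have bc x y (h : pedge x y) :=
  pedge_repE (proj1 (erep0P x y h)) (svalP (cid (vset_ex x))).
exact: (inhabits (@PChoice (fun x => sval (cid (vset_ex x)))
  (fun x => svalP (cid (vset_ex x))) erep0 (fun x y h => proj1 (erep0P x y h))
  erep0V (fun x y h => sval (cid (bc x y h)))
  (fun x y h => sval (cid (svalP (cid (bc x y h)))))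
  (fun x y h => svalP (cid (svalP (cid (bc x y h))))))).
Qed.

Variable ch : pchoice.

Definition pvgrp (x : pvertex) : groupType :=
  pullback (vhom_at muB (pvBA x)) (vhom_at muC (pvCA x)) (vrep ch x).

Definition pegrp (x y : pvertex) (h : pedge x y) : groupType :=
  pullback (ehom_at muB (peBA h)) (ehom_at muC (peCA h)) (erep ch h).

Section ProductEdge.
Variables (x y : pvertex) (h : pedge x y).

Definition palpha_pair (bc : egrp (peB h) * egrp (peC h)) :
    vgrp (pvB x) * vgrp (pvC x) :=
  (brep ch h * alpha (peB h) bc.1 * (brep ch h)^-1,
   crep ch h * alpha (peC h) bc.2 * (crep ch h)^-1).

Lemma palpha_subproof (bc : pegrp h) :
  palpha_pair (val bc) \in pullback_pred (vhom_at muB (pvBA x))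
    (vhom_at muC (pvCA x)) (vrep ch x).
Proof.
rewrite inE /=; apply/eqP.
have JE (G : groupType) (z t : G) : z^-1 * t * z = t ^ z by rewrite /conjg mulgA.
have JVE (G : groupType) (z t : G) : z * t * z^-1 = t ^ z^-1.
  by rewrite /conjg invgK mulgA.
have := pullbackP bc; rewrite !JE !JVE => bcE.
rewrite !gmulfJ !gmulfV [vrep ch x](vrepE ch h) -conjgM !mulgA mulVg mul1g.
rewrite !conjgM -(ehom_at_alpha (peBA h)) -(gmulfJ (alpha (peA h))) bcE.
by rewrite (ehom_at_alpha (peCA h)) conjgK.
Qed.

Definition palpha (bc : pegrp h) : pvgrp x :=
  exist _ (palpha_pair (val bc)) (palpha_subproof bc).

Lemma palpha_monoid : monoid_morphism palpha.
Proof.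
split=> [|s t]; apply/val_inj; rewrite SubK ?val1 ?valM.
  by rewrite /palpha_pair /= !gmulf1 !mulg1 !mulgV.
rewrite !SubK /palpha_pair /=; congr pair; rewrite gmulfM.
  by rewrite !mulgA mulgVK.
by rewrite !mulgA mulgVK.
Qed.
HB.instance Definition _ := isUMagmaMorphism.Build _ _ palpha palpha_monoid.

Lemma palpha_inj : injective palpha.
Proof.
move=> s t /(f_equal val); rewrite !SubK => -[/mulIg/mulgI/alpha_inj s1].
move=> /mulIg/mulgI/alpha_inj s2; apply/val_inj.
by rewrite [LHS]surjective_pairing [RHS]surjective_pairing s1 s2.
Qed.

Definition peflip_pair (bc : egrp (peB h) * egrp (peC h)) :
    egrp (einv (peB h)) * egrp (einv (peC h)) :=
  (eflip (peB h) bc.1, eflip (peC h) bc.2).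

Lemma peflip_subproof (bc : pegrp h) :
  peflip_pair (val bc) \in pullback_pred
    (ehom_at muB (peBA (pedge_inv h))) (ehom_at muC (peCA (pedge_inv h)))
    (erep ch (pedge_inv h)).
Proof.
rewrite inE /=; apply/eqP; rewrite erepV (ehom_atV (peBA h)) (ehom_atV (peCA h)) -pullbackP.
by rewrite !gmulfM gmulfV.
Qed.

Definition peflip (bc : pegrp h) : pegrp (pedge_inv h) :=
  exist _ (peflip_pair (val bc)) (peflip_subproof bc).

Lemma peflip_monoid : monoid_morphism peflip.
Proof.
split=> [|s t]; apply/val_inj; rewrite SubK ?val1 ?valM.
  by rewrite /peflip_pair /= !gmulf1.
by rewrite !SubK /peflip_pair /= !gmulfM.
Qed.
HB.instance Definition _ := isUMagmaMorphism.Build _ _ peflip peflip_monoid.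

End ProductEdge.
Arguments palpha {x y} h bc.
Arguments peflip {x y} h bc.

Lemma peflipK (x y : pvertex) (h : pedge x y) (s : pegrp h) :
  palpha _ (peflip _ (peflip h s)) = palpha h s.
Proof.
apply/val_inj; rewrite !SubK /palpha_pair /peflip_pair /=.
by rewrite pedge_invK !eflipK.
Qed.

Definition aproduct : gog := @Gog pgraph pvgrp pegrp
  (fun x y h => palpha h) (@palpha_inj) (fun x y h => peflip h) peflipK.

End Product.
Arguments pvset {A B C muB muC} p _.
Arguments peset {A B C muB muC x y} p _.

(* Main.v *)
From HB Require Import structures.
Require Import Defs.
From mathcomp Require Import all_boot.
From mathcomp Require Import boolp classical_sets functions.

(** A vertex [x] of the product [D] over [v] and [w] is a double coset, and a
    representative [r] of it is a path of length 0 in [A] between the images of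
    [v] and [w]. The projections [dB] and [dC] of a path [d] of [D] from [x] to
    [y] satisfy [muB(dB) ry = rx muC(dC)] in the fundamental groupoid of [A], see
    [vrep_natural]. Conversely, by [lift_path], any path [b] of [B] and path [c]
    of [C] with [muB(b) ry = rx muC(c)] come from a path of [D]: once [b] and [c]
    are reduced, so are their images, because immersions create no cancellation
    ([pmap_reduced]), and equal reduced paths in [A] cross the same edges and
    differ by elements of the edge groups ([reduced_peq_psim]); these elements are
    points of the edges of [D] to be crossed.

    As equality of the double cosets of [x] and [y] in the fundamental group of
    [A] says precisely that such [b] and [c] exist ([dcrep_eq]), two vertices of
    [D] have the same double coset if and only if a path of [D] joins them. If
    both are in the core, then they are in the same component of the core, because
    a reduced path between vertices of the core never leaves it ([core_gconn]).
    Hence the map on the components of the core is well defined and injective.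

    Its values are as stated because a cyclically reduced circuit of positive
    length is not elliptic ([cyc_reduced_not_elliptic]): such a circuit at a vertex
    of the core of [D] has a cyclically reduced image in [A], as the projection
    of [D] to [B] creates no cancellation either ([projB_reflects]), and the image
    represents an element of the intersection ([theta_core]).

    For surjectivity ([theta_surj]), a non elliptic element of the intersection
    for [g] gives circuits [b] and [c] with [muB(b) k = k muC(c)], where [k] is a
    shortest path obtained from [g] by composition with images of paths of [B] on
    the left and of [C] on the right. As [k] can cancel against neither side, a
    comparison of lengths shows that it has length 0, so that it is a point of a
    vertex of [D] at which [b] and [c] lift to a circuit; this circuit is not
    elliptic and is thus conjugate to a cyclically reduced circuit of positive
    length, whose vertices are in the core. *)

Local Open Scope group_scope.
Local Open Scope classical_set_scope.

Set Implicit Arguments.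
Unset Strict Implicit.
Unset Printing Implicit Defensive.

(** * Normal forms of paths *)

Section NormalForm.

Variable A : gog.
Implicit Types u v w : A.

Lemma Prop_inj_pair2 (T : Type) (P : T -> Type) (t : T) (x y : P t) :
  existT P t x = existT P t y -> x = y.
Proof.
move=> E; have := projT2_eq E.
by rewrite (Prop_irrelevance (projT1_eq E) erefl).
Qed.

Definition path_view u w (p : gpath u w) :
    option {v : A & (vgrp u * edge u v * gpath v w)%type} :=
  match p in gpath u w
    return option {v : A & (vgrp u * edge u v * gpath v w)%type} with
  | Pnil _ _ => None
  | Pcons _ v _ a e p => Some (existT _ v (a, e, p))
  end.

Lemma Pcons_target u v v' w a (e : edge u v) (p : gpath v w)
    a' (e' : edge u v') (p' : gpath v' w) :
  Pcons a e p = Pcons a' e' p' -> v = v'.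
Proof.
by move=> /(f_equal (@path_view u w)) /= /Some_inj E; exact: (f_equal (@projT1 _ _) E).
Qed.

Lemma Pcons_inj u v w a a' (e e' : edge u v) (p p' : gpath v w) :
  Pcons a e p = Pcons a' e' p' -> [/\ a = a', e = e' & p = p'].
Proof.
move=> E; have /= /Some_inj E' := f_equal (@path_view u w) E.
by have E2 := Prop_inj_pair2 E'; case: E2.
Qed.

Lemma tot_inj u v (e e' : edge u v) : tot e = tot e' -> e = e'.
Proof. by move=> E; have E' := Prop_inj_pair2 E; have := Prop_inj_pair2 E'. Qed.

Lemma pfirst_edgeP u v w (q : gpath u w) (e : edge u v) :
  pfirst_edge q = Some (tot e) -> exists q1, q = Pcons (pfirst_el q) e q1.
Proof.
case: q v e => // x y z a f q v e /= /Some_inj E0; have E := Prop_inj_pair2 E0.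
have vy : y = v by exact: (f_equal (@projT1 _ _) E).
by case: v / vy e E0 E => e _ E; rewrite -(Prop_inj_pair2 E); exists q.
Qed.

Lemma plen_plmul u v (a : vgrp u) (p : gpath u v) : plen (plmul a p) = plen p.
Proof. by case: p a. Qed.

Lemma reduced_plmul u v (a : vgrp u) (p : gpath u v) :
  reduced (plmul a p) <-> reduced p.
Proof. by case: p a. Qed.

Lemma omegaM u v (e : edge u v) (x y : egrp e) :
  omega e (x * y) = omega e x * omega e y.
Proof. exact: gmulfM. Qed.

Lemma omegaV u v (e : edge u v) (x : egrp e) : omega e x^-1 = (omega e x)^-1.
Proof. exact: gmulfV. Qed.

Lemma omega_einv u v (e : edge u v) (x : egrp e) :
  omega (einv e) (eflip e x) = alpha e x.
Proof. exact: eflipK. Qed.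

Lemma omega1 u v (e : edge u v) : omega e 1 = 1.
Proof. exact: gmulf1. Qed.

Lemma omega_inj u v (e : edge u v) : injective (omega e).
Proof. by move=> x y /alpha_inj/eflip_inj. Qed.

#[local] Opaque omega.

(** Two paths are similar when they differ by moving elements of edge groups
    across their edges. This is the form that equality in the fundamental
    groupoid takes on reduced paths. *)
Fixpoint psim u v (p : gpath u v) : gpath u v -> Prop :=
  match p in gpath u v return gpath u v -> Prop with
  | Pnil _ a => fun q => q = Pnil a
  | Pcons _ _ _ a e p => fun q => exists x q1,
      q = Pcons (a * alpha e x) e q1 /\ psim p (plmul (omega e x) q1)
  end.

Lemma psim_refl u v (p : gpath u v) : psim p p.
Proof.
elim: p => [//|x y z a e p IH] /=; exists 1, p.
by rewrite gmulf1 omega1 mulg1 plmul1.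
Qed.

Lemma psim_plmul u v (a : vgrp u) (p q : gpath u v) :
  psim p q -> psim (plmul a p) (plmul a q).
Proof.
case: p a q => [x b|x y z b e p] a q /= => [->//|[t [q1 [-> pq]]]].
by exists t, q1; split; rewrite //= mulgA.
Qed.

Lemma psim_trans u v (p q r : gpath u v) : psim p q -> psim q r -> psim p r.
Proof.
elim: p q r => [x a|x y z a e p IH] q r /= => [->//|[t [q1 [-> pq]]]] /=.
move=> [s [r1 [-> qr]]]; exists (t * s), r1; split; first by rewrite gmulfM mulgA.
by apply: (IH _ _ pq); rewrite omegaM -plmulM; exact: psim_plmul.
Qed.

Lemma psim_sym u v (p q : gpath u v) : psim p q -> psim q p.
Proof.
elim: p q => [x a|x y z a e p IH] q /= => [->//|[t [q1 [-> pq]]]] /=.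
exists t^-1, p; split; first by rewrite gmulfV mulgK.
have := psim_plmul (omega e t)^-1 (IH _ pq).
by rewrite plmulM mulVg plmul1 omegaV.
Qed.

Lemma psim_plen u v (p q : gpath u v) : psim p q -> plen p = plen q.
Proof.
elim: p q => [x a|x y z a e p IH] q /= => [->//|[t [q1 [-> /IH ->]]]] /=.
by rewrite plen_plmul.
Qed.

Definition cancels u v w (e : edge u v) (q : gpath v w)
    (xq : egrp e * gpath u w) : Prop :=
  q = Pcons (omega e xq.1) (einv e) xq.2.
Arguments cancels {u v w} e q xq.

(** The path [1, e, q] after the only cancellation that can arise when [q] is
    reduced. *)
Definition push u v w (e : edge u v) (q : gpath v w) : gpath u w :=
  if pselect (exists xq, cancels e q xq) is left h then
    plmul (alpha e (sval (cid h)).1) (sval (cid h)).2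
  else Pcons 1 e q.

Lemma push_cancel u v w (e : edge u v) x (q : gpath u w) :
  push e (Pcons (omega e x) (einv e) q) = plmul (alpha e x) q.
Proof.
rewrite /push; case: pselect => [h|[]]; last by exists (x, q).
by case: (cid h) => -[y q1] /= /Pcons_inj[/omega_inj -> _ ->].
Qed.

Lemma push_cons u v w (e : edge u v) (q : gpath v w) :
  ~ (exists xq, cancels e q xq) -> push e q = Pcons 1 e q.
Proof. by rewrite /push; case: pselect. Qed.

Lemma reduced_Pcons u v w a (e : edge u v) (q : gpath v w) :
  reduced (Pcons a e q) <-> ~ (exists xq, cancels e q xq) /\ reduced q.
Proof.
split=> /= -[nq rq]; split=> //.
  move=> [[x q1]]; rewrite /cancels /= => qE.
  by apply: nq; rewrite qE //=; exists x.
move=> /pfirst_edgeP[q1 qE] [x _ xq]; apply: nq; exists (x, q1).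
by rewrite /cancels /= xq.
Qed.

Lemma cancels_psim u v w (e : edge u v) (q q' : gpath v w) x q1 :
  cancels e q (x, q1) -> psim q q' ->
  exists y q1', cancels e q' (y, q1') /\
    psim (plmul (alpha e x) q1) (plmul (alpha e y) q1').
Proof.
rewrite /cancels /= => -> /= [y [q1' [-> qq']]].
have [z zy] := eflip_surj y.
exists (x * z), q1'; split; first by rewrite -zy omegaM.
rewrite gmulfM -plmulM; apply: psim_plmul; move: qq'.
by rewrite -zy omega_einv.
Qed.

Lemma push_psim u v w (e : edge u v) (q q' : gpath v w) :
  psim q q' -> psim (push e q) (push e q').
Proof.
move=> qq'.
have [[[x q1] xq]|nq] := pselect (exists xq, cancels e q xq).
  have [y [q1' [yq' ?]]] := cancels_psim xq qq'.
  by rewrite xq yq' !push_cancel.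
have nq' : ~ (exists xq, cancels e q' xq).
  move=> [[x q1] xq]; apply: nq.
  by have [y [q1' [yq _]]] := cancels_psim xq (psim_sym qq'); exists (y, q1').
rewrite !push_cons //=; exists 1, q'.
by rewrite gmulf1 omega1 mulg1 plmul1.
Qed.

Lemma push_reduced u v w (e : edge u v) (q : gpath v w) :
  reduced q -> reduced (push e q).
Proof.
have [[[x q1] ->]|nq] := pselect (exists xq, cancels e q xq); last first.
  by rewrite push_cons // => rq; apply/reduced_Pcons.
by rewrite push_cancel => -[_ rq1]; apply/reduced_plmul.
Qed.

(** The defining relation of the fundamental groupoid holds for [push]. If [q]
    cancels, then the path left over cannot cancel again, as [q] is reduced. *)
Lemma push_einv u v w (e : edge u v) x (q : gpath u w) : reduced q ->
  psim (push e (plmul (omega e x) (push (einv e) q))) (plmul (alpha e x) q).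
Proof.
have [[[y q1] yq]|nq] := pselect (exists yq, cancels (einv e) q yq); last first.
  by rewrite (push_cons nq) /= mulg1 push_cancel => _; exact: psim_refl.
have [z zy] := eflip_surj y.
have pq : push (einv e) q = plmul (omega e z) q1.
  by rewrite yq push_cancel -zy.
rewrite pq plmulM -omegaM.
have castE e' (ee' : e' = e) : Pcons (alpha e z) e' q1 = Pcons (alpha e z) e q1.
  by rewrite ee'.
have -> : q = Pcons (alpha e z) e q1.
  by rewrite [LHS]yq /= -zy omega_einv (castE _ (einvK e)).
move=> /reduced_Pcons[nq rq].
rewrite push_cons /=.
  by exists (x * z), q1; rewrite mul1g gmulfM; split=> //; exact: psim_refl.
move=> [[t q2]]; rewrite /cancels /= => /(f_equal (plmul (omega e (x * z))^-1)).
rewrite plmulM mulVg plmul1 /= => q1E.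
by apply: nq; exists ((x * z)^-1 * t, q2); rewrite /cancels q1E -omegaV -omegaM.
Qed.

(** On reduced paths and up to similarity, this is an action of the fundamental
    groupoid, in the manner of van der Waerden. *)
Fixpoint act u v w (p : gpath u v) : gpath v w -> gpath u w :=
  match p in gpath u v return gpath v w -> gpath u w with
  | Pnil _ a => plmul a
  | Pcons _ _ _ a e p => fun q => plmul a (push e (act p q))
  end.

Lemma act_plmul u v w (a : vgrp u) (p : gpath u v) (q : gpath v w) :
  act (plmul a p) q = plmul a (act p q).
Proof. by case: p a q => [x b|x y z b e p] a q /=; rewrite plmulM. Qed.

Lemma act_pcat u v w x (p : gpath u v) (q : gpath v w) (r : gpath w x) :
  act (pcat p q) r = act p (act q r).
Proof.
elim: p w x q r => [y a|y y' y'' a e p IH] w x q r /=; first exact: act_plmul.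
by rewrite IH.
Qed.

Lemma act_reduced u v w (p : gpath u v) (q : gpath v w) :
  reduced q -> reduced (act p q).
Proof.
elim: p w q => [y a|y y' y'' a e p IH] w q rq /=; apply/reduced_plmul => //.
by apply: push_reduced; exact: IH.
Qed.

Lemma act_psim u v w (p : gpath u v) (q q' : gpath v w) :
  psim q q' -> psim (act p q) (act p q').
Proof.
elim: p w q q' => [y a|y y' y'' a e p IH] w q q' qq' /=; apply: psim_plmul => //.
by apply: push_psim; exact: IH.
Qed.

Lemma act_peq u v w (p p' : gpath u v) (q : gpath v w) :
  peq p p' -> reduced q -> psim (act p q) (act p' q).
Proof.
move=> pp'; elim: pp' w q => {u v p p'}.
- by move=> *; exact: psim_refl.
- by move=> u v p p' _ IH w q rq; apply: psim_sym; exact: IH.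
- by move=> u v p p' p'' _ IH _ IH' w q rq; exact: psim_trans (IH _ _ rq) (IH' _ _ rq).
- move=> u v x p p' r r' _ IHp _ IHr w q rq; rewrite !act_pcat.
  apply: psim_trans _ (IHp _ _ (act_reduced r' rq)).
  by apply: act_psim; exact: IHr.
by move=> u v e x w q rq /=; rewrite !plmul1; exact: push_einv.
Qed.

Definition reduce u v (p : gpath u v) : gpath u v := act p (Pnil 1).

Lemma reduce_reduced u v (p : gpath u v) : reduced (reduce p).
Proof. exact: act_reduced. Qed.

Lemma reduce_id u v (p : gpath u v) : reduced p -> psim (reduce p) p.
Proof.
rewrite /reduce; elim: p => [x a|x y z a e p IH]; first by rewrite /= mulg1.
move=> /reduced_Pcons[np /IH sp] /=.
rewrite -[X in psim _ (Pcons X e p)]mulg1 -[Pcons (a * 1) e p]/(plmul a (Pcons 1 e p)).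
by rewrite -(push_cons np); apply: psim_plmul; exact: push_psim.
Qed.

(** The normal form theorem. A reduced path acts on the trivial path by
    rebuilding itself, and equal paths act in the same way up to similarity. *)
Theorem reduced_peq_psim u v (p q : gpath u v) :
  reduced p -> reduced q -> peq p q -> psim p q.
Proof.
move=> rp rq pq; apply: psim_trans (psim_sym (reduce_id rp)) _.
by apply: psim_trans _ (reduce_id rq); exact: act_peq.
Qed.

Lemma push_peq u v w (e : edge u v) (q : gpath v w) :
  peq (push e q) (Pcons 1 e q).
Proof.
have [[[x q1] ->]|nq] := pselect (exists xq, cancels e q xq); last first.
  by rewrite push_cons //; exact: peq_refl.
rewrite push_cancel; apply: peq_sym.
have := peq_cat (peq_edge x) (peq_refl q1).
by rewrite /= plmul1.
Qed.

Lemma peq_Pcons u v w (a : vgrp u) (e : edge u v) (p q : gpath v w) :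
  peq p q -> peq (Pcons a e p) (Pcons a e q).
Proof.
by move=> /(peq_cat (peq_refl (Pcons a e (Pnil 1)))); rewrite /= !plmul1.
Qed.

Lemma peq_plmul u v (a : vgrp u) (p q : gpath u v) :
  peq p q -> peq (plmul a p) (plmul a q).
Proof. by move=> /(peq_cat (peq_refl (Pnil a))). Qed.

Lemma reduce_peq u v (p : gpath u v) : peq (reduce p) p.
Proof.
rewrite /reduce; elim: p => [x a|x y z a e p IH] /=.
  by rewrite mulg1; exact: peq_refl.
have /(peq_plmul a) := push_peq e (act p (Pnil 1)); rewrite /= mulg1.
by move=> /peq_trans; apply; exact: peq_Pcons.
Qed.

Lemma plen_push u v w (e : edge u v) (q : gpath v w) :
  (plen (push e q) <= (plen q).+1)%N.
Proof.
have [[[x q1] ->]|nq] := pselect (exists xq, cancels e q xq); last first.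
  by rewrite push_cons.
by rewrite push_cancel plen_plmul /= ltnW // ltnW.
Qed.

Lemma plen_reduce u v (p : gpath u v) : (plen (reduce p) <= plen p)%N.
Proof.
rewrite /reduce; elim: p => [x a|x y z a e p IH] //=.
by rewrite plen_plmul (leq_trans (plen_push _ _)).
Qed.

Lemma plen_reduce_eq u v (p : gpath u v) :
  (plen p <= plen (reduce p))%N -> reduced p.
Proof.
elim: p => [x a|x y z a e p IH] //.
rewrite /reduce /= plen_plmul -/(reduce p) => pl.
have rp : reduced p by apply: IH; have := leq_trans pl (plen_push _ _).
apply/(reduced_Pcons a); split; last exact: rp.
move=> [[t q] tq]; have [s [q' [sq' _]]] := cancels_psim tq (psim_sym (reduce_id rp)).
move: pl; rewrite sq' push_cancel plen_plmul.
by rewrite -(psim_plen (reduce_id rp)) sq' /= ltnNge !leqnSn.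
Qed.

(** Reduction does not lengthen a path, it shortens every path that is not
    reduced, and similar paths have the same length. *)
Theorem reduced_min u v (p : gpath u v) :
  reduced p <-> forall q, peq p q -> (plen p <= plen q)%N.
Proof.
split=> [rp q pq|H]; last first.
  by apply: plen_reduce_eq; apply: H; apply: peq_sym; exact: reduce_peq.
apply: leq_trans (plen_reduce q).
rewrite (psim_plen (reduced_peq_psim rp (reduce_reduced q) _)) //.
by apply: peq_trans pq _; apply: peq_sym; exact: reduce_peq.
Qed.

End NormalForm.
Arguments cancels {A u v w} e q xq.

(** * Algebra of the fundamental groupoid *)

Section Groupoid.
Variable A : gog.
Implicit Types u v w x : A.

Definition vclass u (a : vgrp u) : groupoid u u := pclass (Pnil a).
Definition eclass u v (e : edge u v) : groupoid u v :=
  pclass (Pcons 1 e (Pnil 1)).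

Lemma pclass_pcat u v w (p : gpath u v) (q : gpath v w) :
  pclass (pcat p q) = gmul (pclass p) (pclass q).
Proof. by rewrite gmulE. Qed.

Lemma pclass_pathV u v (p : gpath u v) : pclass (pathV p) = ginv (pclass p).
Proof. by rewrite ginvE. Qed.

Lemma reduce_pclass u v (p : gpath u v) : pclass (reduce p) = pclass p.
Proof. by apply/pclassP; exact: reduce_peq. Qed.

Lemma gmulgA u v w x (f : groupoid u v) (g : groupoid v w) (h : groupoid w x) :
  gmul f (gmul g h) = gmul (gmul f g) h.
Proof.
elim/groupoid_ind: f => p; elim/groupoid_ind: g => q.
by elim/groupoid_ind: h => r; rewrite !gmulE pcatA.
Qed.

Lemma gmul1g u v (f : groupoid u v) : gmul (vclass 1) f = f.
Proof. by elim/groupoid_ind: f => p; rewrite gmulE /= plmul1. Qed.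

Lemma gmulg1 u v (f : groupoid u v) : gmul f (vclass 1) = f.
Proof. by elim/groupoid_ind: f => p; rewrite gmulE pcat1. Qed.

Lemma gmulVg u v (f : groupoid u v) : gmul (ginv f) f = vclass 1.
Proof.
elim/groupoid_ind: f => p; rewrite ginvE gmulE; apply/pclassP.
exact: pcat_pathVl.
Qed.

Lemma gmulgV u v (f : groupoid u v) : gmul f (ginv f) = vclass 1.
Proof.
elim/groupoid_ind: f => p; rewrite ginvE gmulE; apply/pclassP.
exact: pcat_pathV.
Qed.

Lemma ginvgK u v (f : groupoid u v) : ginv (ginv f) = f.
Proof. by elim/groupoid_ind: f => p; rewrite !ginvE pathVK. Qed.

Lemma ginvM u v w (f : groupoid u v) (g : groupoid v w) :
  ginv (gmul f g) = gmul (ginv g) (ginv f).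
Proof.
elim/groupoid_ind: f => p; elim/groupoid_ind: g => q.
by rewrite gmulE !ginvE gmulE pathV_pcat.
Qed.

Lemma gmulKg u v w (f : groupoid u v) (g : groupoid v w) :
  gmul (ginv f) (gmul f g) = g.
Proof. by rewrite gmulgA gmulVg gmul1g. Qed.

Lemma gmulVKg u v w (f : groupoid v u) (g : groupoid v w) :
  gmul f (gmul (ginv f) g) = g.
Proof. by rewrite gmulgA gmulgV gmul1g. Qed.

Lemma gmulgK u v w (f : groupoid u v) (g : groupoid v w) :
  gmul (gmul f g) (ginv g) = f.
Proof. by rewrite -gmulgA gmulgV gmulg1. Qed.

Lemma gmulgVK u v w (f : groupoid u v) (g : groupoid w v) :
  gmul (gmul f (ginv g)) g = f.
Proof. by rewrite -gmulgA gmulVg gmulg1. Qed.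

Lemma pi1_conjE u (f g : @pi1 A u) : f ^ g = gmul (gmul (ginv g) f) g.
Proof. by rewrite /conjg mulgA. Qed.

Lemma vclassM u (a b : vgrp u) : vclass (a * b) = gmul (vclass a) (vclass b).
Proof. by rewrite gmulE. Qed.

Lemma vclassV u (a : vgrp u) : vclass a^-1 = ginv (vclass a).
Proof. by rewrite ginvE. Qed.

Lemma pclass_plmul u v (a : vgrp u) (p : gpath u v) :
  pclass (plmul a p) = gmul (vclass a) (pclass p).
Proof. by rewrite gmulE. Qed.

Lemma pclass_Pcons u v w (a : vgrp u) (e : edge u v) (p : gpath v w) :
  pclass (Pcons a e p) = gmul (vclass a) (gmul (eclass e) (pclass p)).
Proof. by rewrite /vclass /eclass !gmulE /= plmul1 mulg1. Qed.

Lemma eclassV u v (e : edge u v) : eclass (einv e) = ginv (eclass e).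
Proof. by rewrite /eclass ginvE /= !invg1 mul1g. Qed.

Lemma eclass_omega u v (e : edge u v) (x : egrp e) :
  gmul (eclass e) (vclass (omega e x)) = gmul (vclass (alpha e x)) (eclass e).
Proof.
have := proj2 (pclassP _ _) (peq_edge x); rewrite !pclass_Pcons -!/(vclass _).
by rewrite !gmul1g gmulg1 eclassV => <-; rewrite gmulgA gmulgVK.
Qed.

Lemma eclass_slide u v w (e : edge u v) (x : egrp e) (a a' : vgrp u)
    (b b' : vgrp v) (f : groupoid v w) :
  a * alpha e x = a' -> b = omega e x * b' ->
  gmul (vclass a) (gmul (eclass e) (gmul (vclass b) f)) =
  gmul (vclass a') (gmul (eclass e) (gmul (vclass b') f)).
Proof.
move=> <- ->; rewrite !vclassM -!gmulgA (gmulgA (eclass e) (vclass _)).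
by rewrite eclass_omega -!gmulgA.
Qed.

End Groupoid.

(** * Concatenation of reduced paths *)

Section Junction.
Variable A : gog.
Implicit Types u v w x : A.

(** No cancellation occurs where [q] follows [p]. With [p] for [q], this is the
    condition at the base point in the definition of [cyc_reduced]. *)
Definition junction u v w (p : gpath u v) (q : gpath v w) : Prop :=
  forall x (e : edge v x),
    pfirst_edge q = Some (tot e) -> plast_edge p = Some (tot (einv e)) ->
    ~ range (alpha e) (plast_el p * pfirst_el q).

Lemma range_omega u v (e : edge u v) :
  range (omega e) = range (alpha (einv e)).
Proof.
apply/seteqP; split=> [_ [x _ <-]|a /range_alphaK //].
by exists (eflip e x).
Qed.

Lemma pfirst_edge_plmul u v (a : vgrp u) (p : gpath u v) :
  pfirst_edge (plmul a p) = pfirst_edge p.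
Proof. by case: p a. Qed.

Lemma pfirst_el_plmul u v (a : vgrp u) (p : gpath u v) :
  pfirst_el (plmul a p) = a * pfirst_el p.
Proof. by case: p a. Qed.

Lemma junction_edge u v w (a : vgrp u) (e : edge u v) (b : vgrp v)
    (q : gpath v w) :
  junction (Pcons a e (Pnil b)) q <->
  (pfirst_edge q = Some (tot (einv e)) -> ~ range (omega e) (b * pfirst_el q)).
Proof.
rewrite range_omega; split=> [J qe|J x e' qe /= /Some_inj ee'].
  by apply: (J _ (einv e) qe); rewrite /= einvK.
have ee2 : tot (einv e) = tot e' by rewrite (tot_einv ee') einvK.
apply: (@tot_rect _ _ _ (einv e) (fun _ f => ~ range (alpha f) _) _ _ _ ee2).
by apply: J; rewrite qe ee2.
Qed.

Lemma junction_Pcons u v x y w (a : vgrp u) (e : edge u v) (b : vgrp v)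
    (f : edge v x) (p : gpath x y) (q : gpath y w) :
  junction (Pcons a e (Pcons b f p)) q <-> junction (Pcons b f p) q.
Proof. by rewrite /junction /=; case: (plast_edge p). Qed.

Lemma reduced_pcat u v w (p : gpath u v) (q : gpath v w) :
  reduced (pcat p q) <-> [/\ reduced p, reduced q & junction p q].
Proof.
elim: p w q => [x a|x y z a e p IH] w q /=.
  by rewrite reduced_plmul; split=> [?|[]//]; split.
case: p e IH q => [t b|t t' s b f p] e IH q /=.
  rewrite pfirst_edge_plmul pfirst_el_plmul.
  have rbq := reduced_plmul b q; have J := junction_edge a e b q.
  split=> [[je rq]|[_ rq je]]; split=> //; first exact/rbq.
  - exact/J.
  - by move: je => /J.
  - exact/rbq.
have J := junction_Pcons a e b f p q.
have [IHl IHr] : reduced (pcat (Pcons b f p) q) <->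
    [/\ reduced (Pcons b f p), reduced q & junction (Pcons b f p) q] := IH _ q.
split=> [[ne /IHl[rp rq /J jpq]]|[[ne rp] rq /J jpq]]; first by split.
by split=> //; apply: IHr.
Qed.

Lemma cyc_reducedE u (p : gpath u u) :
  cyc_reduced p <-> reduced (pcat p p).
Proof. by rewrite reduced_pcat; split=> [[]|[]]. Qed.

Lemma plast_pcat u v w (p : gpath u v) (q : gpath v w) : (0 < plen q)%N ->
  plast_edge (pcat p q) = plast_edge q /\ plast_el (pcat p q) = plast_el q.
Proof.
case: q p => // x y z a e q p _.
have le y' z' (e' : edge y' z') w' (q' : gpath z' w') b :
    exists t, plast_edge (Pcons b e' q') = Some t.
  by rewrite /=; case: (plast_edge q') => [t|]; [exists t|exists (tot e')].
elim: p a e => [t b|t t' t'' b f p IH] a e //=.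
by have [-> ->] := IH a e; have [t0 /= ->] := le _ _ e _ q a.
Qed.

Lemma pfirst_pcat u v w (p : gpath u v) (q : gpath v w) : (0 < plen p)%N ->
  pfirst_edge (pcat p q) = pfirst_edge p /\ pfirst_el (pcat p q) = pfirst_el p.
Proof. by case: p q. Qed.

Lemma junction_catl u v w x (p : gpath u v) (q : gpath v w) (r : gpath w x) :
  (0 < plen q)%N -> junction (pcat p q) r <-> junction q r.
Proof. by move=> q0; rewrite /junction; have [-> ->] := plast_pcat p q0. Qed.

Lemma junction_catr u v w x (p : gpath u v) (q : gpath v w) (r : gpath w x) :
  (0 < plen q)%N -> junction p (pcat q r) <-> junction p q.
Proof. by move=> q0; rewrite /junction; have [-> ->] := pfirst_pcat r q0. Qed.

(** Reducedness only concerns consecutive edges, and an edge of [q] separates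
    those of [p] from those of [r]. *)
Lemma reduced_glue u v w x (p : gpath u v) (q : gpath v w) (r : gpath w x) :
  (0 < plen q)%N -> reduced (pcat p q) -> reduced (pcat q r) ->
  reduced (pcat p (pcat q r)).
Proof.
move=> q0 /reduced_pcat[rp _ pq] rqr; apply/reduced_pcat; split=> //.
exact/junction_catr.
Qed.

Lemma cyc_reduced_cube u (p : gpath u u) : (0 < plen p)%N ->
  cyc_reduced p -> reduced (pcat p (pcat p p)).
Proof. by move=> p0 /cyc_reducedE rp; exact: reduced_glue. Qed.

(** Rotating a circuit preserves cyclic reducedness, because the square of the
    rotated circuit is a piece of the cube of the original one. *)
Lemma cyc_reduced_rot u v (p : gpath u v) (q : gpath v u) :
  (0 < plen (pcat p q))%N -> cyc_reduced (pcat p q) -> cyc_reduced (pcat q p).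
Proof.
move=> pq0 /(cyc_reduced_cube pq0) rpq; apply/cyc_reducedE.
have : reduced (pcat p (pcat (pcat (pcat q p) (pcat q p)) q)).
  by rewrite !pcatA -!pcatA; move: rpq; rewrite -!pcatA.
by move=> /reduced_pcat[_ /reduced_pcat[]].
Qed.

Fixpoint ppow u (p : gpath u u) (n : nat) : gpath u u :=
  if n is n'.+1 then pcat p (ppow p n') else Pnil 1.

Lemma plen_ppow u (p : gpath u u) n : plen (ppow p n) = (n * plen p)%N.
Proof. by elim: n => [//|n IH]; rewrite /= plen_pcat IH mulSn. Qed.

Lemma ppow_reduced u (p : gpath u u) n :
  (0 < plen p)%N -> cyc_reduced p -> reduced (ppow p n).
Proof.
move=> p0 cp; have rp : reduced p by case: cp.
elim: n => [//|[|n] IH] /=; first by rewrite pcat1.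
by apply: reduced_glue => //; exact/cyc_reducedE.
Qed.

Definition elliptic u (h : groupoid u u) : Prop :=
  exists v (p : gpath u v) (a : vgrp v),
    gmul (gmul (ginv (pclass p)) h) (pclass p) = pclass (Pnil a).

Lemma elliptic_conj u v (g : groupoid u v) (h : groupoid u u) :
  elliptic h <-> elliptic (gmul (gmul (ginv g) h) g).
Proof.
elim/groupoid_ind: g => r; split=> -[w [p [a E]]].
  exists w, (pcat (pathV r) p), a.
  by rewrite -E pclass_pcat pclass_pathV ginvM ginvgK !gmulgA !gmulgK.
exists w, (pcat r p), a.
by rewrite -E pclass_pcat ginvM !gmulgA.
Qed.

Lemma path_cases u w (p : gpath u w) :
  plen p = 0 \/ exists v a (e : edge u v) q, p = Pcons a e q.
Proof. by case: p => [x a|x y z a e q]; [left|right; exists y, a, e, q]. Qed.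

Lemma plen0_Pnil u (p : gpath u u) : plen p = 0 -> exists a, p = Pnil a.
Proof.
move=> p0; suff : forall v (q : gpath v u), plen q = 0 ->
    exists (E : v = u) a, eq_rect v (gpath^~ u) q u E = Pnil a.
  move=> /(_ _ p p0)[E [a]]; rewrite (Prop_irrelevance E erefl) /= => ->.
  by exists a.
by move=> v; case=> // w b _; exists erefl, b.
Qed.

Lemma elliptic_nil u (p : gpath u u) : plen p = 0 -> elliptic (pclass p).
Proof.
move=> /plen0_Pnil[a ->].
by exists u, (Pnil 1), a; rewrite -/(vclass _) gmulg1 -vclassV invg1 gmul1g.
Qed.

(** The powers of a cyclically reduced circuit of positive length are reduced,
    so their lengths grow linearly; those of an element that is conjugate into
    a vertex group stay bounded. *)
Lemma cyc_reduced_not_elliptic u (p : gpath u u) :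
  (0 < plen p)%N -> cyc_reduced p -> ~ elliptic (pclass p).
Proof.
move=> p0 cp [v [r [a E]]].
pose n := (plen r + plen r).+1.
have En : exists b : vgrp v, pclass (ppow p n) =
    pclass (pcat r (pcat (Pnil b) (pathV r))).
  elim: n => [|n [b IH]].
    by exists 1; rewrite !pclass_pcat pclass_pathV -/(vclass _) gmul1g gmulgV.
  exists (a * b); rewrite /= pclass_pcat IH !pclass_pcat !pclass_plmul.
  by rewrite pclass_pathV vclassM [vclass a](esym E) !gmulgA gmulgV gmul1g.
have [b /pclassP /(proj1 (reduced_min _) (ppow_reduced n p0 cp))] := En.
rewrite plen_ppow !plen_pcat plen_pathV /= => /(leq_trans _) => /(_ n).
by rewrite leq_pmulr // add0n ltnn => /(_ isT).
Qed.

(** A shortest circuit in a conjugacy class is cyclically reduced, since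
    rotating its first edge to the end does not change its length. *)
Lemma cyc_reduced_conj u (p : gpath u u) :
  exists v (r : gpath u v) (c : gpath v v),
    peq p (pcat r (pcat c (pathV r))) /\ cyc_reduced c.
Proof.
pose P n := `[< exists v (r : gpath u v) (c : gpath v v),
  peq p (pcat r (pcat c (pathV r))) /\ plen c = n >].
have exP : exists n, P n.
  exists (plen p); apply/asboolP; exists u, (Pnil 1), p; split=> //=.
  by rewrite invg1 pcat1 plmul1; exact: peq_refl.
case: (ex_minnP exP) => n /asboolP[v [r [c [/pclassP pE <-]]]] nmin.
have cmin w (s : gpath v w) (d : gpath w w) :
    pclass c = pclass (pcat s (pcat d (pathV s))) -> (plen c <= plen d)%N.
  move=> cE; apply: nmin; apply/asboolP; exists w, (pcat r s), d; split=> //.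
  by apply/pclassP; rewrite pE !pclass_pcat cE pathV_pcat !pclass_pcat !gmulgA.
exists v, r, c; split; first exact/pclassP.
have rc : reduced c.
  apply/reduced_min => d /pclassP cd; apply: (cmin _ (Pnil 1)).
  by rewrite cd /= invg1 pcat1 plmul1.
have [/plen0_Pnil[a ->]|[w [a [e [d cE']]]]] := path_cases c.
  exact/cyc_reducedE.
have [d0|d0] := posnP (plen d).
  (* A circuit with a single edge, which is not its own inverse. *)
  split=> //; rewrite cE' => z e' /Some_inj ee' /=.
  have -> : plast_edge d = None by case: d d0 {cE'}.
  by move=> /Some_inj ee; case: (@tot_einv_neq _ _ _ e'); rewrite -ee.
have [s s1 cE] : exists2 s : gpath v w, plen s = 1%N & c = pcat s d.
  by exists (Pcons a e (Pnil 1)); rewrite // cE' /= plmul1.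
have rot : reduced (pcat d s).
  apply/reduced_min => f /pclassP df.
  rewrite plen_pcat addnC -plen_pcat -cE; apply: (cmin _ s f).
  by rewrite cE !pclass_pcat -df pclass_pathV pclass_pcat !gmulgA gmulgK.
rewrite cE in rc *; apply/cyc_reducedE; rewrite -pcatA.
apply: reduced_glue => //; apply: reduced_glue => //; by rewrite s1.
Qed.

End Junction.

(** * The core *)

Section CoreConnected.
Variable A : gog.
Implicit Types u v w x y : A.

Lemma pverts_split u w (p : gpath u w) x : pverts p x ->
  exists (p1 : gpath u x) (p2 : gpath x w), p = pcat p1 p2.
Proof.
elim: p => [y a|y y' y'' a e p IH] /=.
  by move=> ->; exists (Pnil 1), (Pnil a); rewrite /= mul1g.
move=> [->|/IH[p1 [p2 ->]]]; last by exists (Pcons a e p1), p2.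
by exists (Pnil 1), (Pcons a e p); rewrite /= mul1g.
Qed.

Lemma pverts_first u v (p : gpath u v) : pverts p u.
Proof. by case: p => [//|x y z a e p]; left. Qed.

Lemma pedges_verts u v (p : gpath u v) x y (e : edge x y) :
  pedges p (tot e) -> pverts p x /\ pverts p y.
Proof.
elim: p => [//|z z' z'' a f p IH] /= [E|/IH[? ?]]; last by split; right.
have -> : x = z by exact: (f_equal (@projT1 _ _) E).
have -> : y = z' by exact: (f_equal (fun t : tot_edge A => projT1 (projT2 t)) E).
by split; [left|right; exact: pverts_first].
Qed.

Lemma pedges_pcat u v w (p : gpath u v) (q : gpath v w) :
  pedges (pcat p q) = pedges p `|` pedges q.
Proof.
elim: p w q => [x a|x y z a e p IH] w q /=; last by rewrite IH setUA.
by rewrite set0U; case: q a.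
Qed.

Lemma core_vert_circuit x : core_vert x ->
  exists c : gpath x x, (0 < plen c)%N /\ cyc_reduced c.
Proof.
move=> [u [p [cp p0 /pverts_split[p1 [p2 pE]]]]]; rewrite pE in cp p0.
exists (pcat p2 p1); split; last exact: cyc_reduced_rot.
by move: p0; rewrite !plen_pcat addnC.
Qed.

Lemma core_edge_verts x y (e : edge x y) :
  core_edge e -> core_vert x /\ core_vert y.
Proof.
move=> [u [p [cp p0 /pedges_verts[px py]]]].
by split; exists u, p.
Qed.

Lemma core_edge_einvE x y (e : edge x y) : core_edge (einv e) <-> core_edge e.
Proof. by split=> /core_edge_einv //; rewrite einvK. Qed.

Definition core_tot (t : tot_edge A) : Prop := core_edge (projT2 (projT2 t)).

Lemma plast_edge_mem u v (p : gpath u v) t : plast_edge p = Some t -> pedges p t.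
Proof.
elim: p => [//|x y z a e p IH] /=.
case: (plast_edge p) IH => [t'|] IH /Some_inj tE; last by left.
by right; apply: IH; rewrite tE.
Qed.

Lemma pfirst_edge_mem u v (p : gpath u v) t : pfirst_edge p = Some t -> pedges p t.
Proof. by case: p => // x y z a e p /= /Some_inj <-; left. Qed.

Lemma core_tot_mem u (p : gpath u u) t :
  (0 < plen p)%N -> cyc_reduced p -> pedges p t -> core_tot t.
Proof. by case: t => x [y e] p0 cp pt; exists u, p. Qed.

Lemma junction_core u v w (p : gpath u v) (q : gpath v w) (P : bool) :
  (forall t, plast_edge p = Some t -> core_tot t <-> P) ->
  (forall t, pfirst_edge q = Some t -> core_tot t <-> ~~ P) ->
  junction p q.
Proof.
move=> Pp Pq x e /Pq qe /Pp; rewrite [core_tot _]core_edge_einvE.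
by rewrite -[core_edge e]/(core_tot (tot e)) qe; case: (P) => -[? ?] //; exfalso; auto.
Qed.

Lemma gconn_trans (G : graph) (x y z : G) : gconn x y -> gconn y z -> gconn x z.
Proof. by move=> xy; elim=> // t t' _ xt e; exact: gconn_step xt e. Qed.

Lemma gconn_sym (G : graph) (x y : G) : gconn x y -> gconn y x.
Proof.
elim=> [|z t _ IH e]; first exact: gconn_refl.
by apply: gconn_trans IH; apply: gconn_step (einv e); exact: gconn_refl.
Qed.

Lemma component_eq (G : graph) (x y : G) :
  gconn x y -> component x = component y.
Proof.
move=> xy; apply/seteqP; split=> z /=; last exact: gconn_trans.
by apply: gconn_trans; exact: gconn_sym.
Qed.

Lemma path_last u w (p : gpath u w) : (0 < plen p)%N ->
  exists v (q : gpath u v) (f : edge v w) b, p = pcat q (Pcons 1 f (Pnil b)).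
Proof.
elim: p => [//|x y z a e p IH] _.
have [p0|/IH[v [q [f [b ->]]]]] := posnP (plen p); last first.
  by exists v, (Pcons a e q), f, b.
case: p e p0 {IH} => // t b e _.
by exists x, (Pnil a), e, b; rewrite /= mulg1.
Qed.

(** If neither the first nor the last edge of the reduced path [d] from [x] to
    [y] is in the core, then going around a cyclically reduced circuit at [x],
    along [d], around such a circuit at [y] and back along [d] is cyclically
    reduced, as core and other edges alternate at the junctions. *)
Lemma core_end_edge x y (d : gpath x y) t t' : core_vert x -> core_vert y ->
  reduced d -> pfirst_edge d = Some t -> plast_edge d = Some t' ->
  core_tot t \/ core_tot t'.
Proof.
move=> /core_vert_circuit[s [s0 cs]] /core_vert_circuit[s' [s'0 cs']] rd dt dt'.
apply: contrapT => /not_orP[nt nt'].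
have d0 : (0 < plen d)%N by case: d dt {rd dt'}.
have V0 : (0 < plen (pathV d))%N by rewrite plen_pathV.
have sE := core_tot_mem s0 cs; have s'E := core_tot_mem s'0 cs'.
have dl : forall t0, plast_edge d = Some t0 -> core_tot t0 <-> false.
  by move=> t0; rewrite dt' => /Some_inj <-.
have df : forall t0, pfirst_edge d = Some t0 -> core_tot t0 <-> false.
  by move=> t0; rewrite dt => /Some_inj <-.
have Vl : forall t0, plast_edge (pathV d) = Some t0 -> core_tot t0 <-> false.
  by move=> [z [z' e]] /plast_edge_pathV/df <-; rewrite [X in _ <-> X]core_edge_einvE.
have Vf : forall t0, pfirst_edge (pathV d) = Some t0 -> core_tot t0 <-> false.
  move=> [z [z' e]] /pfirst_edge_pathV; rewrite pathVK => /dl <-.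
  by rewrite [X in _ <-> X]core_edge_einvE.
pose X := pcat s (pcat d (pcat s' (pathV d))).
suff cX : cyc_reduced X.
  apply: nt; apply: (core_tot_mem _ cX); first by rewrite plen_pcat ltn_addr.
  by rewrite !pedges_pcat; right; left; exact: pfirst_edge_mem.
have j1 : junction s d.
  by apply: (junction_core (P := true)) => // t0 /plast_edge_mem/sE.
have j2 : junction d s'.
  by apply: (junction_core (P := false)) => // t0 /pfirst_edge_mem/s'E.
have j3 : junction s' (pathV d).
  by apply: (junction_core (P := true)) => // t0 /plast_edge_mem/s'E.
have j4 : junction (pathV d) s.
  by apply: (junction_core (P := false)) => // t0 /pfirst_edge_mem/sE.
split; last first.
  by do 3 (apply/junction_catl; first by rewrite ?plen_pcat ?ltn_addr);
     apply/junction_catr.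
have [[rs _] [rs' _]] := (cs, cs').
apply/reduced_pcat; split=> //; last exact/junction_catr.
apply/reduced_pcat; split=> //; last exact/junction_catr.
by apply/reduced_pcat; split=> //; exact: reduced_pathV.
Qed.

(** The first or the last edge of a reduced path between vertices of the core is
    in the core; by induction on its length, the path stays in the core. *)
Lemma core_gconn x y (hx : core_vert x) (hy : core_vert y) :
  gpath x y -> @gconn (core A) (exist _ x hx) (exist _ y hy).
Proof.
move=> d; have [n] := ubnP (plen (reduce d)).
have := reduce_reduced d; move: (reduce d) => {}d.
elim: n => // n IH in x y hx hy d * => rd dn.
case: (path_cases d) => [d0|[z [a [e [d1 dE]]]]].
  case: d d0 hx hy {rd dn} => // u a _ hx hy.
  by rewrite (Prop_irrelevance hx hy); exact: gconn_refl.
have d0 : (0 < plen d)%N by rewrite dE.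
have [v [q [f [b dE']]]] := path_last d0.
have [] : core_tot (tot e) \/ core_tot (tot f).
- apply: (@core_end_edge _ _ d) => //; first by rewrite dE.
  by rewrite dE' plast_edge_cat.
- move=> ce; have [_ hz] := core_edge_verts ce.
  apply: (@gconn_trans (core A) _ (exist _ z hz)); last apply: (IH z y hz hy d1).
  + apply: (@gconn_step (core A) _ (exist _ x hx)); first exact: gconn_refl.
    exact: (exist _ e ce).
  + by move: rd; rewrite dE => -[].
  + by move: dn; rewrite dE.
- move=> cf; have [hv _] := core_edge_verts cf.
  apply: (@gconn_step (core A) _ (exist _ v hv)); last exact: (exist _ f cf).
  apply: (IH _ _ _ _ q); first by move: rd; rewrite dE' => /reduced_pcat[].
  by move: dn; rewrite dE' plen_pcat addn1.
Qed.

End CoreConnected.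

(** * Double cosets of ranges *)

Section DoubleCosets.
Variables (G H K : groupType) (phi : {ghom G -> K}) (psi : {ghom H -> K}).

Lemma mem_dcoset a s t : dcoset (range phi) (range psi) a (phi s * a * psi t).
Proof. by exists (phi s); [exists s|exists (psi t); first by exists t]. Qed.

Lemma dcosetP a b : dcoset (range phi) (range psi) a b <->
  exists s t, b = phi s * a * psi t.
Proof.
split=> [[_ [s _ <-] [_ [t _ <-] <-]]|[s [t ->]]]; first by exists s, t.
exact: mem_dcoset.
Qed.

Lemma dcoset_refl a : dcoset (range phi) (range psi) a a.
Proof. by apply/dcosetP; exists 1, 1; rewrite !gmulf1 mul1g mulg1. Qed.

Lemma dcoset_eq a b : dcoset (range phi) (range psi) a b ->
  dcoset (range phi) (range psi) a = dcoset (range phi) (range psi) b.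
Proof.
move=> /dcosetP[s [t ->]]; apply/seteqP; split=> z /dcosetP[s' [t' ->]];
    apply/dcosetP.
  by exists (s' * s^-1), (t^-1 * t'); rewrite !gmulfM !gmulfV !mulgA mulgVK mulgK.
by exists (s' * s), (t * t'); rewrite !gmulfM !mulgA.
Qed.

End DoubleCosets.

Local Notation pmap := Defs.pmap.

(** * Immersions *)

Section Immersion.
Variables (B A : gog) (mu : gmorph B A).

(** The form in which immersions are used: a cancellation between the images of
    two edges comes from a cancellation between the edges. *)
Definition reflects_cancellation : Prop :=
  forall (v v1 v2 : B) (f : edge v v1) (f' : edge v v2) (b : vgrp v),
    tot (emap mu f) = tot (emap mu f') ->
    range (alpha (emap mu f)) ((twa mu f)^-1 * vhom mu v b * twa mu f') ->
    tot f = tot f' /\ range (alpha f) b.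

(** Condition (i) identifies the two edges, and condition (ii) then yields the
    element of the edge group. *)
Lemma immersion_reflects : immersion mu -> reflects_cancellation.
Proof.
move=> [imm1 imm2] v v1 v2 f f' b ee' [z _ zE].
have ff' : tot f = tot f'.
  apply/(imm1 _ _ _ _ _ ee').
  have <- : range (alpha (emap mu f)) = range (alpha (emap mu f')).
    exact: (@tot_rect _ _ _ (emap mu f)
      (fun _ e => range (alpha (emap mu f)) = range (alpha e)) erefl _ _ ee').
  apply: dcoset_eq; apply/dcosetP; exists b^-1, z.
  by rewrite zE gmulfV !mulgA mulgK mulVg mul1g.
split=> //; have ta : twa mu f = twa mu f'.
  exact: (@tot_rect _ _ _ f (fun _ k => twa mu f = twa mu k) erefl _ _ ff').
have : ((conj_set (range (vhom mu v)) (twa mu f)) `&` range (alpha (emap mu f)))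
    (alpha (emap mu f) z).
  split; last by exists z.
  by exists (vhom mu v b); [exists b|rewrite zE -ta /conjg mulgA].
rewrite -imm2 => -[y _]; rewrite ehom_alpha zE -ta /conjg mulgA.
by move=> /mulIg/mulgI/vhom_inj <-; exists y.
Qed.

Lemma pmap_reduced (v v' : B) (p : gpath v v') :
  reflects_cancellation -> reduced p -> reduced (pmap mu p).
Proof.
move=> loc; elim: p => [//|v1 v2 v3 b f p IH] [np rp].
have {IH rp} rp := IH rp; split; last exact/reduced_plmul.
rewrite pfirst_edge_plmul pfirst_el_plmul range_omega.
case: p f np {rp} => // w w' w'' b' f' p f np /Some_inj ee'.
rewrite -emapV -twaV mulgA => r.
have [|ff'] := loc _ _ _ (einv f) f' b' _ r; first by rewrite ee' emapV.
by rewrite -range_omega => fb; apply: np => //=; rewrite ff'.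
Qed.

Lemma plen_pmap (v v' : B) (p : gpath v v') : plen (pmap mu p) = plen p.
Proof. by elim: p => [//|v1 v2 v3 b f p IH] /=; rewrite plen_plmul IH. Qed.

Lemma pmap_pathV (v v' : B) (p : gpath v v') : pmap mu (pathV p) = pathV (pmap mu p).
Proof.
elim: p => [v1 b|v1 v2 v3 b f p IH] /=; first by rewrite gmulfV.
rewrite pmap_pcat IH pathV_plmul invgK -pcatA /= emapV twaV twoV.
by rewrite gmulf1 mul1g mulg1 gmulfV invgM.
Qed.

End Immersion.

Lemma cancel_shorter {A : gog} {u v w : A} (a : vgrp u) (e : edge u v)
    (k : gpath v w) : reduced k -> ~ reduced (Pcons a e k) ->
  exists k', peq (Pcons a e k) k' /\ (plen k' < plen k)%N.
Proof.
move=> rk nr.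
have [[[x q] xq]|nq] := pselect (exists xq, cancels e k xq); last first.
  by case: nr; apply/reduced_Pcons.
exists (plmul a (push e k)); split; last by rewrite xq push_cancel !plen_plmul /=.
have := peq_plmul a (peq_sym (push_peq e k)).
by rewrite /= mulg1.
Qed.

(** If [k] cancelled against [b], then the last edge of [b] alone would already
    make [k] shorter. *)
Lemma minimal_reduced {B A : gog} (mu : gmorph B A) {v : B} {u : A}
    (k : gpath (mu v) u) : reflects_cancellation mu ->
  (forall (v' : B) (s : gpath v' v) k',
     peq (pcat (pmap mu s) k) k' -> (plen k <= plen k')%N) ->
  forall (v' : B) (b : gpath v' v), reduced b -> (0 < plen b)%N ->
    reduced (pcat (pmap mu b) k).
Proof.
move=> loc kmin v' b rb b0.
have rk : reduced k.
  apply/reduced_min => k' kk'; apply: (kmin _ (Pnil 1)).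
  by rewrite /= gmulf1 plmul1.
apply/reduced_pcat; split=> //; first exact: pmap_reduced.
have [v1 [q [f [c ->]]]] := path_last b0.
rewrite pmap_pcat; apply/junction_catl; first by rewrite plen_pmap.
set s := Pcons 1 f (Pnil c).
suff /reduced_pcat[] : reduced (pcat (pmap mu s) k) by [].
apply: contrapT => nr.
have [||k' [sk' lt]] :=
    @cancel_shorter A _ _ _ (vhom mu v1 1 * twa mu f) (emap mu f)
      (plmul ((two mu f)^-1 * vhom mu v c) k);
  [exact/reduced_plmul|exact: nr|].
have := kmin _ s k' sk'; rewrite leqNgt => /negP; apply.
by move: lt; rewrite plen_plmul.
Qed.

(** * Morphisms read at given images of the end points *)

Section PathsAt.
Variables (B A : gog) (mu : gmorph B A).
Implicit Types (v : B) (u : A).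

Lemma pmap_at_Pnil v u (h : mu v = u) (b : vgrp v) :
  pmap_at mu h h (Pnil b) = Pnil (vhom_at mu h b).
Proof. by case: u / h. Qed.

Lemma pmap_at_Pcons v v1 v2 u u1 u2 (h : mu v = u) (h1 : mu v1 = u1)
    (h2 : mu v2 = u2) (b : vgrp v) (f : edge v v1) (p : gpath v1 v2) :
  pmap_at mu h h2 (Pcons b f p) =
  Pcons (vhom_at mu h b * twa_at mu h f) (emap_at mu h h1 f)
    (plmul (two_at mu h1 f)^-1 (pmap_at mu h1 h2 p)).
Proof. by case: u / h; case: u1 / h1; case: u2 / h2. Qed.

Lemma pmap_at_pcat v v1 v2 u u1 u2 (h : mu v = u) (h1 : mu v1 = u1)
    (h2 : mu v2 = u2) (p : gpath v v1) (q : gpath v1 v2) :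
  pmap_at mu h h2 (pcat p q) = pcat (pmap_at mu h h1 p) (pmap_at mu h1 h2 q).
Proof. by case: u / h; case: u1 / h1; case: u2 / h2; exact: pmap_pcat. Qed.

Lemma pmap_at_plmul v v1 u u1 (h : mu v = u) (h1 : mu v1 = u1) (b : vgrp v)
    (p : gpath v v1) :
  pmap_at mu h h1 (plmul b p) = plmul (vhom_at mu h b) (pmap_at mu h h1 p).
Proof. by case: u / h; case: u1 / h1; exact: pmap_plmul. Qed.

Lemma pmap_at_pathV v v1 u u1 (h : mu v = u) (h1 : mu v1 = u1) (p : gpath v v1) :
  pmap_at mu h1 h (pathV p) = pathV (pmap_at mu h h1 p).
Proof. by case: u / h; case: u1 / h1; exact: pmap_pathV. Qed.

Lemma pmap_at_pclass v v1 u u1 (h : mu v = u) (h1 : mu v1 = u1)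
    (p q : gpath v v1) : pclass p = pclass q ->
  pclass (pmap_at mu h h1 p) = pclass (pmap_at mu h h1 q).
Proof.
by case: u / h; case: u1 / h1 => /pclassP pq; apply/pclassP; exact: pmap_peq.
Qed.

Lemma pmap_at_reduced v v1 u u1 (h : mu v = u) (h1 : mu v1 = u1)
    (p : gpath v v1) : reflects_cancellation mu ->
  reduced p -> reduced (pmap_at mu h h1 p).
Proof. by case: u / h; case: u1 / h1; exact: pmap_reduced. Qed.

Lemma plen_pmap_at v v1 u u1 (h : mu v = u) (h1 : mu v1 = u1) (p : gpath v v1) :
  plen (pmap_at mu h h1 p) = plen p.
Proof. by case: u / h; case: u1 / h1; exact: plen_pmap. Qed.

Lemma pi1_map_atE v u (h : mu v = u) (p : gpath v v) :
  pi1_map_at mu h (pclass p) = pclass (pmap_at mu h h p).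
Proof. by case: u / h; exact: pi1_mapE. Qed.

Lemma reflects_cancellation_at v v1 v2 u u1 u2 (h : mu v = u) (h1 : mu v1 = u1)
    (h2 : mu v2 = u2) (f : edge v v1) (f' : edge v v2) (b : vgrp v) :
  reflects_cancellation mu ->
  tot (emap_at mu h h1 f) = tot (emap_at mu h h2 f') ->
  range (alpha (emap_at mu h h1 f))
    ((twa_at mu h f)^-1 * vhom_at mu h b * twa_at mu h f') ->
  tot f = tot f' /\ range (alpha f) b.
Proof. by case: u / h; case: u1 / h1; case: u2 / h2 => loc; exact: loc. Qed.

Lemma emap_at_tot v v1 v2 u u1 u2 (h : mu v = u) (h1 : mu v1 = u1)
    (h2 : mu v2 = u2) (f : edge v v1) (f' : edge v v2) : tot f = tot f' ->
  tot (emap_at mu h h1 f) = tot (emap_at mu h h2 f') /\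
  twa_at mu h f = twa_at mu h f'.
Proof.
move=> ff'; apply: (@tot_rect _ _ _ f (fun w k => forall u2 (h2 : mu w = u2),
  tot (emap_at mu h h1 f) = tot (emap_at mu h h2 k) /\
  twa_at mu h f = twa_at mu h k) _ _ _ ff').
by case: u1 / h1 => ? h1; case: _ / h1.
Qed.

Lemma cyc_reduced_pmap_at (v : B) (u : A) (h : mu v = u) (p : gpath v v) :
  reflects_cancellation mu -> cyc_reduced p -> cyc_reduced (pmap_at mu h h p).
Proof.
move=> loc /cyc_reducedE rp; apply/cyc_reducedE.
by rewrite -pmap_at_pcat; exact: pmap_at_reduced.
Qed.

Lemma minimal_reduced_at (v : B) (u u' : A) (h : mu v = u) (k : gpath u u') :
  reflects_cancellation mu ->
  (forall (v' : B) (s : gpath v' v) k',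
     peq (pcat (pmap_at mu (erefl (mu v')) h s) k) k' -> (plen k <= plen k')%N) ->
  forall b : gpath v v, reduced b -> (0 < plen b)%N ->
    reduced (pcat (pmap_at mu h h b) k).
Proof. by case: u / h k => k loc kmin b; exact: (minimal_reduced loc kmin). Qed.

End PathsAt.

(** * The product and its projections *)

Section PullbackProjections.
Variables (G H K : groupType) (phi : {ghom G -> K}) (psi : {ghom H -> K}).
Variable a : K.

Definition pullback_fst (s : pullback phi psi a) : G := (val s).1.
Definition pullback_snd (s : pullback phi psi a) : H := (val s).2.

Lemma pullback_fst_monoid : monoid_morphism pullback_fst.
Proof. by split=> [|s t]; rewrite /pullback_fst ?val1 ?valM. Qed.
HB.instance Definition _ :=
  isUMagmaMorphism.Build _ _ pullback_fst pullback_fst_monoid.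

Lemma pullback_snd_monoid : monoid_morphism pullback_snd.
Proof. by split=> [|s t]; rewrite /pullback_snd ?val1 ?valM. Qed.
HB.instance Definition _ :=
  isUMagmaMorphism.Build _ _ pullback_snd pullback_snd_monoid.

Lemma pullback_sndE (s : pullback phi psi a) :
  psi (pullback_snd s) = a^-1 * phi (pullback_fst s) * a.
Proof. by rewrite /pullback_snd -pullbackP. Qed.

Lemma pullback_fst_inj : injective psi -> injective pullback_fst.
Proof.
move=> psi_inj s t st; apply/val_inj.
rewrite [LHS]surjective_pairing [RHS]surjective_pairing; congr pair => //.
by apply: psi_inj; rewrite -!/(pullback_snd _) !pullback_sndE st.
Qed.

Lemma pullback_snd_inj : injective phi -> injective pullback_snd.
Proof.
move=> phi_inj s t st; apply/val_inj.
rewrite [LHS]surjective_pairing [RHS]surjective_pairing; congr pair => //.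
have /(f_equal psi) := st; rewrite !pullback_sndE => /mulIg/mulgI.
exact: phi_inj.
Qed.

Lemma pullback_ex g h : psi h = a^-1 * phi g * a ->
  exists s : pullback phi psi a, pullback_fst s = g /\ pullback_snd s = h.
Proof.
move=> E; have gh : (g, h) \in pullback_pred phi psi a by rewrite inE /= E.
by exists (exist _ (g, h) gh).
Qed.

End PullbackProjections.

Section ProductEquality.
Variables (A B C : gog) (muB : gmorph B A) (muC : gmorph C A).
Implicit Types x y : pvertex muB muC.

Lemma pvset_dcoset x a : pvset x a ->
  pvset x = dcoset (range (vhom_at muB (pvBA x))) (range (vhom_at muC (pvCA x))) a.
Proof. by have [a0 ->] := pvsetP x; exact: dcoset_eq. Qed.

Lemma peset_dcoset x y (h : pedge x y) a : peset h a ->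
  peset h = dcoset (range (ehom_at muB (peBA h))) (range (ehom_at muC (peCA h))) a.
Proof. by have [a0 [-> _ _]] := pesetP h; exact: dcoset_eq. Qed.

Lemma pedge_terminus x y (h : pedge x y) a : peset h a ->
  pvset y (two_at muB (pvBA y) (peB h) * omega (peA h) a *
           (two_at muC (pvCA y) (peC h))^-1).
Proof.
have [a0 [-> _ ->]] := pesetP h => /dcosetP[s [t ->]]; apply/dcosetP.
exists (omega (peB h) s), (omega (peC h) t).
rewrite 2!gmulfM (ehom_at_omega (peBA h)) (ehom_at_omega (peCA h)) /conjg.
by rewrite !mulgA mulgV mul1g mulgK.
Qed.

(** An edge of the product with given origin is determined by its projections
    and its double coset. As the edges of [A] below [h] and [h'] are only provably
    equal, the double cosets are compared through their images in the vertex
    group of the origin. *)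
Lemma pedge_eq_over x y y' (h : pedge x y) (h' : pedge x y') a a' s t :
  tot (peB h) = tot (peB h') -> tot (peC h) = tot (peC h') ->
  peset h a -> peset h' a' ->
  alpha (peA h') a' =
    alpha (peA h) (ehom_at muB (peBA h) s * a * ehom_at muC (peCA h) t) ->
  existT (pedge x) y h = existT (pedge x) y' h'.
Proof.
case: x h h' a a' s t => u v w hB hC S SP.
case: y => u1 v1 w1 hB1 hC1 S1 SP1; case: y' => u1' v1' w1' hB1' hC1' S1' SP1'.
move=> h h' a a' s t fE gE ha ha' aE.
have := (fun b (hb : peset h b) => pvset_dcoset (pedge_terminus hb)).
have := pvset_dcoset (pedge_terminus ha').
have := peset_dcoset ha; have := peset_dcoset ha'.
case: h a s t fE gE ha aE => e f g /= eB eC T TP a s t fE gE ha aE.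
case: h' a' fE gE ha' aE => e' f' g' /= eB' eC' T' TP' a' fE gE ha' aE.
have vE := f_equal (fun t : tot_edge B => projT1 (projT2 t)) fE.
have wE := f_equal (fun t : tot_edge C => projT1 (projT2 t)) gE.
rewrite /= in vE wE; subst v1' w1'.
have {}fE := tot_inj fE; have {}gE := tot_inj gE; subst f' g'.
destruct hB, hB1, hB1', eB, eB'; simpl in *.
have ? := Prop_irrelevance hC1' hC1; subst hC1'.
have ? := Prop_irrelevance eC' eC; subst eC'.
have {}aE := alpha_inj _ _ _ aE; subst a' => T'E TE S1'E S1E.
have Ta : T (ehom muB f s * a * ehom_at muC eC t).
  by rewrite TE; exact: mem_dcoset.
have S1S : S1' = S1 := etrans S1'E (esym (S1E _ Ta)).
have T'T : T' = T.
  by rewrite T'E TE; apply: esym; apply: dcoset_eq; exact: mem_dcoset.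
clear T'E TE S1'E S1E; subst S1' T'.
have ? := Prop_irrelevance SP1' SP1; subst SP1'.
by have ? := Prop_irrelevance TP' TP; subst TP'.
Qed.




End ProductEquality.

Section Projections.
Variables (A B C : gog) (muB : gmorph B A) (muC : gmorph C A).
Variable ch : pchoice muB muC.
Local Notation D := (aproduct ch).

Definition projB_v (x : D) : {ghom vgrp x -> vgrp (pvB x)} :=
  @pullback_fst _ _ _ (vhom_at muB (pvBA x)) (vhom_at muC (pvCA x)) (vrep ch x).
Definition projC_v (x : D) : {ghom vgrp x -> vgrp (pvC x)} :=
  @pullback_snd _ _ _ (vhom_at muB (pvBA x)) (vhom_at muC (pvCA x)) (vrep ch x).
Definition projB_e (x y : D) (h : edge x y) : {ghom egrp h -> egrp (peB h)} :=
  @pullback_fst _ _ _ (ehom_at muB (peBA h)) (ehom_at muC (peCA h)) (erep ch h).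
Definition projC_e (x y : D) (h : edge x y) : {ghom egrp h -> egrp (peC h)} :=
  @pullback_snd _ _ _ (ehom_at muB (peBA h)) (ehom_at muC (peCA h)) (erep ch h).

Lemma projB_v_inj (x : D) : injective (projB_v x).
Proof. by apply: pullback_fst_inj; exact: vhom_at_inj. Qed.

Lemma projC_v_inj (x : D) : injective (projC_v x).
Proof. by apply: pullback_snd_inj; exact: vhom_at_inj. Qed.

Lemma projB_e_inj (x y : D) (h : edge x y) : injective (projB_e h).
Proof. by apply: pullback_fst_inj; exact: ehom_at_inj. Qed.

Lemma projC_e_inj (x y : D) (h : edge x y) : injective (projC_e h).
Proof. by apply: pullback_snd_inj; exact: ehom_at_inj. Qed.

Definition projB_twa (x y : D) (h : edge x y) : vgrp (pvB x) := brep ch h.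
Definition projB_two (x y : D) (h : edge x y) : vgrp (pvB y) :=
  brep ch (pedge_inv h).
Definition projC_twa (x y : D) (h : edge x y) : vgrp (pvC x) := crep ch h.
Definition projC_two (x y : D) (h : edge x y) : vgrp (pvC y) :=
  crep ch (pedge_inv h).

Lemma projB_alpha (x y : D) (h : edge x y) (s : egrp h) :
  alpha (peB h) (projB_e h s) = projB_v x (alpha h s) ^ projB_twa h.
Proof.
rewrite /projB_v /= /pullback_fst SubK /palpha_pair /= /projB_twa.
by rewrite /conjg !mulgA mulgVK mulVg mul1g.
Qed.

Lemma projC_alpha (x y : D) (h : edge x y) (s : egrp h) :
  alpha (peC h) (projC_e h s) = projC_v x (alpha h s) ^ projC_twa h.
Proof.
rewrite /projC_v /= /pullback_snd SubK /palpha_pair /= /projC_twa.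
by rewrite /conjg !mulgA mulgVK mulVg mul1g.
Qed.

Lemma projB_omega (x y : D) (h : edge x y) (s : egrp h) :
  omega (peB h) (projB_e h s) = projB_v y (omega h s) ^ projB_two h.
Proof. by rewrite -(projB_alpha (h := einv h)). Qed.

Lemma projC_omega (x y : D) (h : edge x y) (s : egrp h) :
  omega (peC h) (projC_e h s) = projC_v y (omega h s) ^ projC_two h.
Proof. by rewrite -(projC_alpha (h := einv h)). Qed.

Lemma projB_twoV (x y : D) (h : edge x y) : projB_two (einv h) = projB_twa h.
Proof. by rewrite /projB_two pedge_invK. Qed.

Lemma projC_twoV (x y : D) (h : edge x y) : projC_two (einv h) = projC_twa h.
Proof. by rewrite /projC_two pedge_invK. Qed.

Definition projB : gmorph D B := @GMorph D B (@pvB _ _ _ muB muC)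
  (@peB _ _ _ muB muC) (fun _ _ _ => erefl) projB_v projB_v_inj projB_e
  projB_e_inj projB_twa projB_two (fun _ _ _ => erefl) projB_twoV
  projB_alpha projB_omega.

Definition projC : gmorph D C := @GMorph D C (@pvC _ _ _ muB muC)
  (@peC _ _ _ muB muC) (fun _ _ _ => erefl) projC_v projC_v_inj projC_e
  projC_e_inj projC_twa projC_two (fun _ _ _ => erefl) projC_twoV
  projC_alpha projC_omega.

Lemma vrep_omega (x y : D) (h : edge x y) :
  vrep ch y = vhom_at muB (pvBA y) (projB_two h) * two_at muB (pvBA y) (peB h) *
    omega (peA h) (erep ch h) * (two_at muC (pvCA y) (peC h))^-1 *
    (vhom_at muC (pvCA y) (projC_two h))^-1.
Proof.
rewrite (vrepE ch (pedge_inv h)) erepV -!twa_atV.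
by [].
Qed.

(** The representatives of the vertices are a natural transformation between the
    two functors from the fundamental groupoid of the product to that of [A]. For
    an edge, naturality is the equation that defines [brep] and [crep], read at
    both of its ends. *)
Lemma vrep_natural (x y : D) (d : gpath x y) :
  gmul (pclass (pmap_at muB (pvBA x) (pvBA y) (pmap projB d)))
       (vclass (vrep ch y)) =
  gmul (vclass (vrep ch x))
       (pclass (pmap_at muC (pvCA x) (pvCA y) (pmap projC d))).
Proof.
have vE (z : D) (s : vgrp z) :
    vhom_at muB (pvBA z) (vhom projB z s) * vrep ch z =
    vrep ch z * vhom_at muC (pvCA z) (vhom projC z s).
  rewrite [X in _ = _ * X](pullback_sndE (s : pvgrp ch z)).
  by rewrite !mulgA mulgV mul1g.
elim: d => [z s|z z' z'' s h d IH] /=.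
  by rewrite !pmap_at_Pnil -!vclassM vE.
rewrite (pmap_at_Pcons _ (pvBA z')) (pmap_at_Pcons _ (pvCA z')).
rewrite !pmap_at_plmul !pclass_Pcons !pclass_plmul -!gmulgA IH.
rewrite (peBA h) (peCA h).
have yE : (two_at muB (pvBA z') (peB h))^-1 *
      vhom_at muB (pvBA z') (two projB h)^-1 * vrep ch z' =
    omega (peA h) (erep ch h) * ((two_at muC (pvCA z') (peC h))^-1 *
      vhom_at muC (pvCA z') (two projC h)^-1).
  by rewrite (vrep_omega h) !gmulfV !mulgA mulgVK mulVg mul1g.
have xE : vhom_at muB (pvBA z) (vhom projB z s * twa projB h) *
      twa_at muB (pvBA z) (peB h) * alpha (peA h) (erep ch h) =
    vrep ch z * (vhom_at muC (pvCA z) (vhom projC z s * twa projC h) *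
      twa_at muC (pvCA z) (peC h)).
  rewrite !gmulfM !mulgA -vE [in RHS](vrepE ch h) !mulgA.
  by rewrite mulgVK mulgVK.
do 2 (rewrite !(gmulgA (vclass _) (vclass _)) -!vclassM).
by apply: eclass_slide; [exact: xE|rewrite !mulgA in yE *; exact: yE].
Qed.


(** Immersions are stable under base change: for two edges at [x], the two
    expressions of the representative of [x] that they provide turn a cancellation
    between their projections to [B] into one between their projections to
    [C]. *)
Lemma projB_reflects : reflects_cancellation muC -> reflects_cancellation projB.
Proof.
move=> locC x y y' h h' s ff' [z _ zE].
pose b := pullback_fst (s : pvgrp ch x); pose c := pullback_snd (s : pvgrp ch x).
have [eB' tB] := emap_at_tot (pvBA x) (pvBA y) (pvBA y') ff'.
have ee' : tot (peA h) = tot (peA h') by rewrite -(peBA h) -(peBA h').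
(* The representative of [h'], read in the edge group of [h]. *)
have [ep epE] : exists ep, alpha (peA h) ep = alpha (peA h') (erep ch h').
  have : range (alpha (peA h')) (alpha (peA h') (erep ch h')) by exists (erep ch h').
  have -> : range (alpha (peA h')) = range (alpha (peA h)).
    exact: (@tot_rect _ _ _ (peA h)
      (fun _ e => range (alpha e) = range (alpha (peA h))) erefl _ _ ee').
  by move=> [ep _ <-]; exists ep.
have {}zE : alpha (peB h) z = (brep ch h)^-1 * b * brep ch h' by exact: zE.
have zA := ehom_at_alpha (peBA h) z.
have key : (twa_at muC (pvCA x) (peC h))^-1 *
    vhom_at muC (pvCA x) ((crep ch h)^-1 * c * crep ch h') *
    twa_at muC (pvCA x) (peC h') =
    alpha (peA h) ((erep ch h)^-1 * ehom_at muB (peBA h) z * ep).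
  have cE : vhom_at muC (pvCA x) c =
      (vrep ch x)^-1 * vhom_at muB (pvBA x) b * vrep ch x.
    exact: pullback_sndE.
  rewrite !gmulfM !gmulfV cE zA zE epE {1}(vrepE ch h) (vrepE ch h') tB.
  rewrite /conjg !gmulfM !gmulfV !invgM !invgK !mulgA.
  by rewrite !mulgVK mulVg mul1g.
have gE' : tot (emap_at muC (pvCA x) (pvCA y) (peC h)) =
    tot (emap_at muC (pvCA x) (pvCA y') (peC h')) by rewrite (peCA h) (peCA h').
have [|gE [z' _ z'E]] := reflects_cancellation_at locC gE'
    (b := (crep ch h)^-1 * c * crep ch h').
  by rewrite key (peCA h); eexists.
have [_ tC] := emap_at_tot (pvCA x) (pvCA y) (pvCA y') gE.
have z'A : ehom_at muC (peCA h) z' =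
    (erep ch h)^-1 * ehom_at muB (peBA h) z * ep.
  apply: (alpha_inj (peA h)); rewrite -key (ehom_at_alpha (peCA h)) z'E tC.
  by rewrite /conjg mulgA.
have hh' : existT (pedge x) y h = existT (pedge x) y' h'.
  apply: (pedge_eq_over (s := z^-1) (t := z') ff' gE (erepP ch h) (erepP ch h')).
  by rewrite -epE z'A gmulfV !mulgA mulgK mulVg mul1g.
have yy' := f_equal (@projT1 _ _) hh'; rewrite /= in yy'; subst y'.
have {}hh' := Prop_inj_pair2 hh'; subst h'; split=> //.
have {}epE := alpha_inj _ _ _ epE; subst ep.
have [k [k1 k2]] := pullback_ex z'A; exists (k : pegrp ch h) => //.
apply: val_inj; rewrite [RHS]surjective_pairing -[RHS]/(b, c).
transitivity (brep ch h * alpha (peB h) (pullback_fst k) * (brep ch h)^-1,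
  crep ch h * alpha (peC h) (pullback_snd k) * (crep ch h)^-1); first by [].
by rewrite k1 k2 zE z'E !mulgA !mulgK !mulgV !mul1g.
Qed.

End Projections.

(** * Lifting paths to the product *)

Section Lift.
Variables (A B C : gog) (muB : gmorph B A) (muC : gmorph C A).
Variable ch : pchoice muB muC.
Local Notation D := (aproduct ch).
Local Notation pv u v w hB hC S SP := (@PVertex A B C muB muC u v w hB hC S SP).

Lemma vrep_dcoset (x : D) :
  pvset x = dcoset (range (vhom_at muB (pvBA x))) (range (vhom_at muC (pvCA x)))
    (vrep ch x).
Proof. by apply: pvset_dcoset; exact: vrepP. Qed.

(** Similar paths cross the same edges, and the element [xi] that the similarity
    moves across the first edge is a point of the edge of the product to be
    crossed. The factor [b0] is there for the induction: passing from [xi] to the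
    chosen representative of this edge multiplies the remaining paths by elements
    of vertex groups. *)
Lemma lift_psim (v v' : B) (b : gpath v v') (w w' : C) (c : gpath w w')
    (b0 : vgrp v) (u u' : A) (hB : muB v = u) (hB' : muB v' = u')
    (hC : muC w = u) (hC' : muC w' = u') S SP S' SP' :
  psim (pcat (pmap_at muB hB hB' (plmul b0 b))
          (Pnil (vrep ch (pv u' v' w' hB' hC' S' SP'))))
       (plmul (vrep ch (pv u v w hB hC S SP)) (pmap_at muC hC hC' c)) ->
  exists d : @gpath D (pv u v w hB hC S SP) (pv u' v' w' hB' hC' S' SP'),
    peq (pmap (projB ch) d : gpath v v') (plmul b0 b).
Proof.
elim: b w w' c b0 u u' hB hB' hC hC' S SP S' SP'
    => [{}v b|{}v v1 {}v' b f b1 IH] w w' c b0 u u' hB hB' hC hC' S SP S' SP'.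
  destruct hB, hB'.
  case: c hC hC' SP SP' => [{}w c|{}w w1 {}w' c g c1] hC hC' SP SP'; last first.
    by rewrite (pmap_at_Pcons _ erefl) /= => /(f_equal (@plen _ _ _)).
  have ? := Prop_irrelevance hC' hC; subst hC'.
  rewrite pmap_at_Pnil => E.
  have {}E : vrep ch (pv _ v w erefl hC S SP) * vhom_at muC hC c =
      vhom_at muB erefl (b0 * b) * vrep ch (pv _ v w erefl hC S' SP').
    by move: E => /(f_equal (@pfirst_el _ _ _)).
  have ? : S' = S.
    rewrite -[S']/(pvset (pv _ v w erefl hC S' SP')).
    rewrite -[S]/(pvset (pv _ v w erefl hC S SP)).
    rewrite !vrep_dcoset /=; apply: dcoset_eq; apply/dcosetP.
    by exists (b0 * b), c^-1; rewrite gmulfV -E mulgK.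
  subst S'; have ? := Prop_irrelevance SP' SP; subst SP'.
  have [|d [d1 d2]] := @pullback_ex _ _ _ (vhom_at muB erefl) (vhom_at muC hC)
     (vrep ch (pv _ v w erefl hC S SP)) (b0 * b) c.
    by rewrite -mulgA -E mulKg.
  exists (@Pnil D (pv _ v w erefl hC S SP) d) => /=; rewrite d1.
  exact: peq_refl.
rewrite [plmul _ _]/= (pmap_at_Pcons _ erefl); set e := emap_at _ _ _ _.
case: c hC hC' SP SP' => [{}w c|{}w w1 {}w' c g c1] hC hC' SP SP'.
  move=> [xi [q1 [/(f_equal (@plen _ _ _)) + _]]].
  by destruct hC; destruct hC'.
move=> [xi [q1 []]].
rewrite (pmap_at_Pcons _ erefl) => cE; have hC1 := Pcons_target cE.
move: cE; rewrite -(pmap_at_Pcons _ erefl) (pmap_at_Pcons _ hC1).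
move=> /Pcons_inj[vE gE <-] {q1} tailE.
set P := pmap_at muB erefl hB' b1 in tailE.
set Q := pmap_at muC hC1 hC' c1 in tailE.
set x := pv u v w hB hC S SP; set y := pv u' v' w' hB' hC' S' SP'.
have {}tailE : psim (plmul (two_at muB erefl f)^-1 (pcat P (Pnil (vrep ch y))))
    (plmul (omega e xi * (two_at muC hC1 g)^-1) Q).
  by rewrite -pcat_plmul -plmulM.
have xE : vrep ch x = vhom_at muB hB (b0 * b) * twa_at muB hB f * alpha e xi *
    (twa_at muC hC g)^-1 * (vhom_at muC hC c)^-1.
  by rewrite -vE mulgA !mulgK.
pose Z := dcoset (range (vhom_at muB erefl)) (range (vhom_at muC hC1))
  (two_at muB erefl f * omega e xi * (two_at muC hC1 g)^-1).
have ZP : exists a,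
    Z = dcoset (range (vhom_at muB erefl)) (range (vhom_at muC hC1)) a.
  by eexists.
pose z := pv _ v1 w1 erefl hC1 Z ZP.
have hP : exists a, [/\
    dcoset (range (ehom_at muB (erefl e))) (range (ehom_at muC gE)) xi =
      dcoset (range (ehom_at muB (erefl e))) (range (ehom_at muC gE)) a,
    pvset x = dcoset (range (vhom_at muB (pvBA x))) (range (vhom_at muC (pvCA x)))
      (twa_at muB (pvBA x) f * alpha e a * (twa_at muC (pvCA x) g)^-1) &
    pvset z = dcoset (range (vhom_at muB (pvBA z))) (range (vhom_at muC (pvCA z)))
      (two_at muB (pvBA z) f * omega e a * (two_at muC (pvCA z) g)^-1)].
  exists xi; split=> //; rewrite vrep_dcoset; apply: esym; apply: dcoset_eq.
  by apply/dcosetP; exists (b0 * b), c^-1; rewrite xE gmulfV !mulgA.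
pose h : pedge x z := @PEdge A B C muB muC x z e f g erefl gE _ hP.
have /dcosetP[s [t sxit]] := erepP ch h.
have zE : vrep ch z = vhom_at muB erefl (brep ch (pedge_inv h)) *
    two_at muB erefl f * omega e (erep ch h) * (two_at muC hC1 g)^-1 *
    (vhom_at muC hC1 (crep ch (pedge_inv h)))^-1 := @vrep_omega _ _ _ _ _ ch x z h.
have hE : vrep ch x = vhom_at muB hB (brep ch h) * twa_at muB hB f *
    alpha e (erep ch h) * (twa_at muC hC g)^-1 * (vhom_at muC hC (crep ch h))^-1.
  exact: (vrepE ch h).
(* The factors by which the remaining paths are to be multiplied. *)
pose b0' := brep ch (pedge_inv h) * omega f s.
pose c0' := crep ch (pedge_inv h) * (omega g t)^-1.
have key : vhom_at muB erefl b0' * two_at muB erefl f *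
      (omega e xi * (two_at muC hC1 g)^-1) =
    vrep ch z * vhom_at muC hC1 c0'.
  have sE : vhom_at muB erefl (omega f s) * two_at muB erefl f =
      two_at muB erefl f * omega e (ehom_at muB (erefl e) s).
    by rewrite (ehom_at_omega (erefl e)) /conjg mulVKg.
  have tE : omega e (ehom_at muC gE t) * (two_at muC hC1 g)^-1 =
      (two_at muC hC1 g)^-1 * vhom_at muC hC1 (omega g t).
    by rewrite (ehom_at_omega gE) /conjg mulgA mulgK.
  rewrite zE sxit !omegaM [vhom_at muB _ b0']gmulfM [vhom_at muC _ c0']gmulfM.
  rewrite [vhom_at muC _ (omega _ _)^-1]gmulfV !mulgA mulgVK.
  rewrite -(mulgA _ _ (two_at _ _ _)) sE.
  by rewrite -(mulgA _ (omega e (ehom_at muC _ _))) tE !mulgA mulgK.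
have [|d1 d1E] := IH _ _ (plmul c0' c1) b0' _ _ erefl hB' hC1 hC' Z ZP S' SP'.
  rewrite !pmap_at_plmul pcat_plmul plmulM -key.
  have := psim_plmul (vhom_at muB erefl b0' * two_at muB erefl f) tailE.
  by rewrite !plmulM mulgK.
have [|d0 [d01 d02]] := @pullback_ex _ _ _ (vhom_at muB hB) (vhom_at muC hC)
     (vrep ch x) (b0 * b * (alpha f s)^-1 * (brep ch h)^-1)
     (c * alpha g t * (crep ch h)^-1).
  have sE : vhom_at muB hB (alpha f s) * twa_at muB hB f =
      twa_at muB hB f * alpha e (ehom_at muB (erefl e) s).
    by rewrite (ehom_at_alpha (erefl e)) /conjg mulVKg.
  have tE : alpha e (ehom_at muC gE t) * (twa_at muC hC g)^-1 =
      (twa_at muC hC g)^-1 * vhom_at muC hC (alpha g t).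
    by rewrite (ehom_at_alpha gE) /conjg mulgA mulgK.
  have eE : alpha e (erep ch h) = alpha e (ehom_at muB (erefl e) s) * alpha e xi *
      alpha e (ehom_at muC gE t) by rewrite sxit !gmulfM.
  have bE : vhom_at muB hB (b0 * b * (alpha f s)^-1 * (brep ch h)^-1) =
      vhom_at muB hB (b0 * b) * (vhom_at muB hB (alpha f s))^-1 *
      (vhom_at muB hB (brep ch h))^-1 by rewrite 2!gmulfM !gmulfV.
  have cE : vhom_at muC hC (c * alpha g t * (crep ch h)^-1) = vhom_at muC hC c *
      vhom_at muC hC (alpha g t) * (vhom_at muC hC (crep ch h))^-1.
    by rewrite 2!gmulfM gmulfV.
  apply: (mulgI (vrep ch x)); rewrite bE cE !mulgA mulgV mul1g.
  rewrite [in LHS]xE [in RHS]hE eE !mulgA !mulgVK.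
  rewrite -[in RHS](mulgA _ (twa_at _ _ _)) -sE !mulgA mulgVK.
  by rewrite -[in RHS](mulgA _ (alpha e (ehom_at muC _ _))) tE !mulgA.
exists (@Pcons D x z y d0 h d1).
apply/pclassP; rewrite [LHS]pclass_Pcons [RHS]pclass_Pcons.
rewrite [pclass (plmul _ _)]pclass_plmul (proj2 (pclassP _ _) d1E) pclass_plmul.
rewrite (gmulgA (vclass _) (vclass _)) -vclassM -[X in _ = gmul _ (gmul _ X)]gmul1g.
apply: (eclass_slide (x := s)).
  by rewrite [vhom _ _ _]d01 !mulgVK.
by rewrite mulg1; exact: mulKg.
Qed.
(** The converse of [vrep_natural]: as far as paths are concerned, the product is
    a fibre product. *)
Lemma lift_path (x y : D) (b : gpath (pvB x) (pvB y))
    (c : gpath (pvC x) (pvC y)) :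
  reflects_cancellation muB -> reflects_cancellation muC ->
  gmul (pclass (pmap_at muB (pvBA x) (pvBA y) b)) (vclass (vrep ch y)) =
  gmul (vclass (vrep ch x)) (pclass (pmap_at muC (pvCA x) (pvCA y) c)) ->
  exists d : gpath x y, pclass (pmap (projB ch) d) = pclass b.
Proof.
move=> locB locC.
have bE := proj2 (pclassP _ _) (reduce_peq b).
have cE := proj2 (pclassP _ _) (reduce_peq c).
rewrite -(pmap_at_pclass (pvBA x) (pvBA y) bE).
rewrite -(pmap_at_pclass (pvCA x) (pvCA y) cE) -bE.
have := reduce_reduced b; have := reduce_reduced c.
move: (reduce b) (reduce c) => {bE cE} {}b {}c; rewrite -(plmul1 b).
case: x b c => u v w hB hC S SP; case: y => u' v' w' hB' hC' S' SP' /= b c.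
rewrite reduced_plmul -pclass_pcat -pclass_plmul => rc rb /pclassP E.
have [|d dE] := @lift_psim v v' b w w' c 1 u u' hB hB' hC hC' S SP S' SP'.
  apply: reduced_peq_psim E; last exact/reduced_plmul/pmap_at_reduced.
  apply/reduced_pcat; split=> //; apply: pmap_at_reduced => //.
  exact/reduced_plmul.
by exists d; exact/pclassP.
Qed.

End Lift.

(** * The map to double cosets *)

Section DoubleCosetMap.
Variables (A B C : gog) (muB : gmorph B A) (muC : gmorph C A).
Variable ch : pchoice muB muC.
Variables (u0 : A) (v0 : B) (w0 : C) (hB : muB v0 = u0) (hC : muC w0 = u0).
Variables (p : forall v : B, gpath v0 v) (q : forall w : C, gpath w0 w).
Hypotheses (locB : reflects_cancellation muB) (locC : reflects_cancellation muC).
Local Notation D := (aproduct ch).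
Local Notation H := (range (pi1_map_at muB hB)).
Local Notation K := (range (pi1_map_at muC hC)).
Local Notation mB h h' b := (pclass (pmap_at muB h h' b)).
Local Notation mC h h' c := (pclass (pmap_at muC h h' c)).

Definition dcrep (x : D) (a : vgrp (pvA x)) : pi1 u0 :=
  pclass (pcat (pcat (pmap_at muB hB (pvBA x) (p (pvB x))) (Pnil a))
               (pathV (pmap_at muC hC (pvCA x) (q (pvC x))))).

Definition theta (x : D) : set (pi1 u0) := dcoset H K (dcrep (vrep ch x)).

Lemma dcrepE (x : D) (a : vgrp (pvA x)) :
  dcrep a = gmul (gmul (mB hB (pvBA x) (p (pvB x))) (vclass a))
                 (ginv (mC hC (pvCA x) (q (pvC x)))).
Proof. by rewrite /dcrep !pclass_pcat pclass_pathV. Qed.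

(** The elements of the two subgroups relating the double cosets of [x] and [y]
    become, by conjugation with the fixed paths to the base points, paths between
    the projections of [x] and [y]. *)
Lemma dcrep_eq (x y : D) (a : vgrp (pvA x)) (a' : vgrp (pvA y)) :
  dcoset H K (dcrep a) = dcoset H K (dcrep a') <->
  exists b c, gmul (mB (pvBA x) (pvBA y) b) (vclass a') =
              gmul (vclass a) (mC (pvCA x) (pvCA y) c).
Proof.
have mulE u (f g : pi1 u) : f * g = gmul f g by [].
split=> [E|[b [c E]]].
  have := dcoset_refl (pi1_map_at muB hB) (pi1_map_at muC hC) (dcrep a').
  rewrite -E => /dcosetP[h [k]].
  elim/groupoid_ind: h => h; elim/groupoid_ind: k => k.
  rewrite !pi1_map_atE !mulE !dcrepE => E'.
  exists (pcat (pathV (p (pvB x))) (pcat (pathV h) (p (pvB y)))).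
  exists (pcat (pathV (q (pvC x))) (pcat k (q (pvC y)))).
  rewrite !(pmap_at_pcat _ hB) !(pmap_at_pcat _ hC) !pmap_at_pathV.
  rewrite !pclass_pcat !pclass_pathV -!gmulgA.
  move: E' => /(f_equal (fun f => gmul f (mC hC (pvCA y) (q (pvC y))))).
  by rewrite gmulgVK => ->; rewrite -!gmulgA !gmulKg.
apply: dcoset_eq; apply/dcosetP.
exists (pclass (pcat (p (pvB y)) (pcat (pathV b) (pathV (p (pvB x)))))).
exists (pclass (pcat (q (pvC x)) (pcat c (pathV (q (pvC y)))))).
rewrite !pi1_map_atE !(pmap_at_pcat _ (pvBA _)) !(pmap_at_pcat _ (pvCA _)).
rewrite !pmap_at_pathV !mulE !dcrepE !pclass_pcat !pclass_pathV !gmulgA.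
by rewrite !gmulgVK -(gmulgA _ (vclass a)) -E gmulgA gmulgVK.
Qed.

Lemma theta_rep (x : D) (a : vgrp (pvA x)) :
  pvset x a -> theta x = dcoset H K (dcrep a).
Proof.
rewrite vrep_dcoset => /dcosetP[s [t ->]]; apply/dcrep_eq.
exists (Pnil s^-1), (Pnil t); rewrite !pmap_at_Pnil -!vclassM.
by rewrite gmulfV !mulgA mulVg mul1g.
Qed.

Lemma theta_gpath (x y : D) : gpath x y -> theta x = theta y.
Proof.
move=> d; apply/dcrep_eq; exists (pmap (projB ch) d), (pmap (projC ch) d).
exact: vrep_natural.
Qed.

Lemma theta_inj (x y : D) : theta x = theta y -> exists d : gpath x y, True.
Proof.
by move=> /dcrep_eq[b [c /(lift_path locB locC)[d _]]]; exists d.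
Qed.

(** The witness is the image of a cyclically reduced circuit at [x], conjugated
    to the base point: it comes from [B] as well as from [C]. *)
Lemma theta_core (x : D) : core_vert x ->
  ~ locally_elliptic (conj_set H (dcrep (vrep ch x)) `&` K).
Proof.
move=> /core_vert_circuit[d [d0 cd]] LE.
pose b := pmap (projB ch) d; pose c := pmap (projC ch) d.
have cb : cyc_reduced (pmap_at muB (pvBA x) (pvBA x) b).
  apply: cyc_reduced_pmap_at => //.
  have locD := projB_reflects (ch := ch) locC.
  exact: (@cyc_reduced_pmap_at _ _ (projB ch) x _ erefl d locD).
have := cyc_reduced_not_elliptic _ cb.
rewrite plen_pmap_at (plen_pmap (projB ch) d) => /(_ d0); apply.
pose g := gmul (vclass (vrep ch x)) (ginv (mC hC (pvCA x) (q (pvC x)))).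
apply/(elliptic_conj g); apply: LE; split.
  exists (pclass (pmap_at muB hB hB
      (pcat (p (pvB x)) (pcat b (pathV (p (pvB x))))))).
    by rewrite -pi1_map_atE; eexists.
  rewrite !(pmap_at_pcat _ (pvBA x)) pmap_at_pathV pi1_conjE dcrepE.
  rewrite !pclass_pcat pclass_pathV /g !ginvM !ginvgK -!gmulgA.
  by rewrite !gmulKg.
exists (pclass (pcat (q (pvC x)) (pcat c (pathV (q (pvC x)))))) => //.
rewrite pi1_map_atE !(pmap_at_pcat _ (pvCA x)) pmap_at_pathV.
rewrite !pclass_pcat pclass_pathV.
have E : gmul (mB (pvBA x) (pvBA x) b) (vclass (vrep ch x)) =
    gmul (vclass (vrep ch x)) (mC (pvCA x) (pvCA x) c) := vrep_natural d.
by rewrite /g ginvM ginvgK -!gmulgA (gmulgA (mB _ _ b)) E -!gmulgA gmulKg.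
Qed.

(** A shortest path [k] obtained from [g] by composition with images of paths of
    [B] on the left and of [C] on the right has length 0. Indeed a non elliptic
    element of the intersection gives reduced circuits [b] and [c] of positive
    length with [b k = k c], and [k] cancels against neither of them: if its
    length were positive, the path [b^-1 k c] would be reduced, equal to [k] and
    longer than [k]. *)
Lemma theta_surj (g : pi1 u0) :
  ~ locally_elliptic (conj_set H g `&` K) ->
  exists x : D, core_vert x /\ theta x = dcoset H K g.
Proof.
move=> nLE.
have [b0 [c0 [bcE nell]]] : exists b0 c0,
    gmul (gmul (ginv g) (mB hB hB b0)) g = mC hC hC c0 /\ ~ elliptic (mC hC hC c0).
  apply: contrapT => nex; apply: nLE => _ [[_ [h _ <-] <-] [k _]].
  elim/groupoid_ind: h => b0; elim/groupoid_ind: k => c0.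
  rewrite !pi1_map_atE pi1_conjE => cE; apply: contrapT => ne; apply: nex.
  by exists b0, c0; rewrite -cE in ne *.
pose P n := `[< exists u u' v w (hv : muB v = u) (hw : muC w = u')
    (s : gpath v v0) (t : gpath w0 w) (k : gpath u u'),
  pclass k = gmul (gmul (mB hv hB s) g) (mC hC hw t) /\ plen k = n >].
have exP : exists n, P n.
  exists (plen (repr g)); apply/asboolP.
  exists u0, u0, v0, w0, hB, hC, (Pnil 1), (Pnil 1), (repr g); split=> //.
  by rewrite !pmap_at_Pnil !gmulf1 gmul1g gmulg1 pclassK.
case: (ex_minnP exP) => n /asboolP[u [u' [v [w [hv [hw [s [t [k [kE <-]]]]]]]]]] kmin.
pose b := reduce (pcat s (pcat b0 (pathV s))).
pose c := reduce (pcat (pathV t) (pcat c0 t)).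
have bE : mB hv hv b = gmul (mB hv hB s) (gmul (mB hB hB b0) (ginv (mB hv hB s))).
  rewrite (pmap_at_pclass _ _ (reduce_pclass _)) !(pmap_at_pcat _ hB).
  by rewrite pmap_at_pathV !pclass_pcat pclass_pathV.
have cE : mC hw hw c = gmul (ginv (mC hC hw t)) (gmul (mC hC hC c0) (mC hC hw t)).
  rewrite (pmap_at_pclass _ _ (reduce_pclass _)) !(pmap_at_pcat _ hC).
  by rewrite pmap_at_pathV !pclass_pcat pclass_pathV.
have bkc : gmul (mB hv hv b) (pclass k) = gmul (pclass k) (mC hw hw c).
  rewrite bE cE kE -bcE -!gmulgA; congr (gmul _ _).
  by rewrite !gmulKg !gmulVKg.
have nellc : ~ elliptic (mC hw hw c).
  by rewrite cE gmulgA => /(proj2 (elliptic_conj _ _)).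
have nellb : ~ elliptic (mB hv hv b).
  move=> ell; apply: nellc; rewrite -[mC hw hw c](gmulKg (pclass k)) -bkc gmulgA.
  exact: (proj1 (elliptic_conj _ _)).
have c_gt0 : (0 < plen c)%N.
  rewrite lt0n; apply/negP => /eqP c00; apply: nellc.
  by apply: elliptic_nil; rewrite plen_pmap_at.
have b_gt0 : (0 < plen b)%N.
  rewrite lt0n; apply/negP => /eqP b00; apply: nellb.
  by apply: elliptic_nil; rewrite plen_pmap_at.
have kb v' (s' : gpath v' v) k' :
    peq (pcat (pmap_at muB (erefl (muB v')) hv s') k) k' -> (plen k <= plen k')%N.
  move=> /pclassP k'E; apply: kmin; apply/asboolP.
  exists (muB v'), u', v', w, erefl, hw, (pcat s' s), t, k'; split=> //.
  by rewrite -k'E pclass_pcat kE (pmap_at_pcat _ hv) pclass_pcat -!gmulgA.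
have kc w' (t' : gpath w' w) k' :
    peq (pcat (pmap_at muC (erefl (muC w')) hw t') (pathV k)) k' ->
    (plen (pathV k) <= plen k')%N.
  move=> /pclassP k'E; rewrite plen_pathV -(plen_pathV k').
  apply: kmin; apply/asboolP.
  exists u, (muC w'), v, w', hv, erefl, s, (pcat t (pathV t')), (pathV k'); split=> //.
  rewrite pclass_pathV -k'E pclass_pcat pclass_pathV ginvM ginvgK kE.
  by rewrite (pmap_at_pcat _ hw) pclass_pcat pmap_at_pathV pclass_pathV -!gmulgA.
have rbk : reduced (pcat (pmap_at muB hv hv (pathV b)) k).
  apply: minimal_reduced_at => //; last by rewrite plen_pathV.
  by apply: reduced_pathV; exact: reduce_reduced.
have rkc : reduced (pcat k (pmap_at muC hw hw c)).
  have : reduced (pcat (pmap_at muC hw hw (pathV c)) (pathV k)).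
    apply: minimal_reduced_at => //; last by rewrite plen_pathV.
    by apply: reduced_pathV; exact: reduce_reduced.
  by move=> /reduced_pathV; rewrite pathV_pcat -pmap_at_pathV !pathVK.
have k0 : plen k = 0.
  apply/eqP; rewrite -leqn0 leqNgt; apply/negP => k_gt0.
  have /reduced_min/(_ k) := reduced_glue k_gt0 rbk rkc.
  rewrite !plen_pcat !plen_pmap_at plen_pathV leqNgt => /(_ _)/negP; apply.
    by apply/pclassP; rewrite !pclass_pcat pmap_at_pathV pclass_pathV -bkc gmulKg.
  by rewrite addnCA -[X in (X < _)%N]addn0 ltn_add2l addn_gt0 b_gt0.
have uu' : u = u' by case: (k) k0.
destruct uu'; have [a ka] := plen0_Pnil k0; rewrite ka -!/(vclass a) in kE bkc.
pose X := dcoset (range (vhom_at muB hv)) (range (vhom_at muC hw)) a.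
have XP : exists a, X = dcoset (range (vhom_at muB hv)) (range (vhom_at muC hw)) a.
  by exists a.
pose x : D := @PVertex A B C muB muC u v w hv hw X XP.
have xa : pvset x a by exact: dcoset_refl.
have [s' [t' xE]] : exists s' t',
    vrep ch x = vhom_at muB hv s' * a * vhom_at muC hw t'.
  by apply/dcosetP; exact: (vrepP ch x).
(* The conjugation passes from the point [a] to the representative of [x]. *)
have [|d dE] := @lift_path _ _ _ _ _ ch x x
    (pcat (Pnil s') (pcat b (Pnil s'^-1)))
    (pcat (Pnil t'^-1) (pcat c (Pnil t'))) locB locC.
  rewrite !(pmap_at_pcat _ hv) !(pmap_at_pcat _ hw) !pmap_at_Pnil !pclass_pcat.
  rewrite -!/(vclass _) !gmulfV !vclassV xE !vclassM -!gmulgA.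
  by rewrite gmulKg gmulVKg (gmulgA (mB hv hv b)) bkc -gmulgA.
have [y [r [c' [/pclassP dr cc']]]] := cyc_reduced_conj d.
exists y; split; last first.
  rewrite -(theta_gpath r) (theta_rep xa).
  apply: dcoset_eq; apply/dcosetP.
  exists (pclass (pcat (pathV s) (pathV (p v)))), (pclass (pcat (q w) (pathV t))).
  rewrite !pi1_map_atE !(pmap_at_pcat _ hv) !(pmap_at_pcat _ hw) !pmap_at_pathV.
  rewrite !pclass_pcat !pclass_pathV dcrepE kE.
  have mulE (f h : pi1 u0) : f * h = gmul f h by [].
  by rewrite !mulE -!gmulgA !gmulKg gmulgV gmulg1.
have c'0 : (0 < plen c')%N.
  rewrite lt0n; apply/negP => /eqP c'0; apply: nellb.
  have d1 : mB hv hv (pmap (projB ch) d) =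
      gmul (vclass (vhom_at muB hv s'))
        (gmul (mB hv hv b) (ginv (vclass (vhom_at muB hv s')))).
    rewrite (pmap_at_pclass hv hv dE) !(pmap_at_pcat _ hv) !pmap_at_Pnil.
    by rewrite !pclass_pcat -!/(vclass _) gmulfV vclassV.
  pose f := mB hv (pvBA y) (pmap (projB ch) r).
  have d2 : mB hv hv (pmap (projB ch) d) =
      gmul f (gmul (mB (pvBA y) (pvBA y) (pmap (projB ch) c')) (ginv f)).
    have /pclassP dr' := pmap_peq (projB ch) (proj1 (pclassP _ _) dr).
    rewrite (pmap_at_pclass hv hv dr') !pmap_pcat pmap_pathV.
    by rewrite !(pmap_at_pcat _ (pvBA y)) pmap_at_pathV !pclass_pcat pclass_pathV.
  apply/(elliptic_conj (gmul (ginv (vclass (vhom_at muB hv s'))) f)).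
  rewrite ginvM ginvgK -!gmulgA (gmulgA (mB hv hv b)) (gmulgA (vclass _)) -d1 d2.
  rewrite -!gmulgA gmulKg gmulVg gmulg1.
  by apply: elliptic_nil; rewrite plen_pmap_at (plen_pmap (projB ch) c').
by exists y, c'; split=> //; exact: pverts_first.
Qed.

Lemma theta_gconn (x y : core D) :
  gconn x y -> theta (sval x) = theta (sval y).
Proof.
elim=> // y' z _ ->; case=> e _; apply: theta_gpath.
exact: (Pcons 1 e (Pnil 1)).
Qed.

End DoubleCosetMap.

Unset Implicit Arguments.
Set Strict Implicit.

Theorem theoremC (A B C : gog) (muB : gmorph B A) (muC : gmorph C A)
    (immB : immersion muB) (immC : immersion muC)
    (conB : connected B) (conC : connected C)
    (ch : pchoice muB muC)
    (u0 : A) (v0 : B) (w0 : C) (hB : muB v0 = u0) (hC : muC w0 = u0)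
    (p : forall v : B, gpath v0 v) (q : forall w : C, gpath w0 w) :
  let D : gog := aproduct ch in
  let H : set (pi1 u0) := range (pi1_map_at muB hB) in
  let K : set (pi1 u0) := range (pi1_map_at muC hC) in
  exists theta : D -> set (pi1 u0),
    (forall (x : D) (a : vgrp (pvA x)), pvset x a ->
       theta x = dcoset H K (pclass
         (pcat (pcat (pmap_at muB hB (pvBA x) (p (pvB x))) (Pnil a))
               (pathV (pmap_at muC hC (pvCA x) (q (pvC x))))))) /\
    exists Theta : set (core D) -> set (pi1 u0),
      (forall x : core D, Theta (component x) = theta (sval x)) /\
      set_bij (components (core D))
        [set dcoset H K g |
           g in [set g | ~ locally_elliptic (conj_set H g `&` K)]]
        Theta.
Proof.
move=> D H K.
have locB := immersion_reflects immB; have locC := immersion_reflects immC.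
pose th : D -> set (pi1 u0) := theta hB hC p q.
exists th; split; first exact: theta_rep.
pose Theta (S : set (core D)) : set (pi1 u0) :=
  if pselect (exists x, S = component x) is left h then th (sval (sval (cid h)))
  else set0.
have ThetaE (x : core D) : Theta (component x) = th (sval x).
  rewrite /Theta; case: pselect => [h|[]]; last by exists x.
  case: (cid h) => y /= xy; apply: theta_gconn.
  by rewrite -[gconn y x]/(component y x) -xy; exact: gconn_refl.
exists Theta; split=> //; split.
- move=> _ [x _ <-]; rewrite ThetaE.
  exists (dcrep hB hC p q (vrep ch (sval x))) => //.
  by apply: theta_core => //; exact: svalP.
- move=> _ _ /set_mem[x _ <-] /set_mem[y _ <-]; rewrite !ThetaE.
  move=> /(theta_inj locB locC)[d _]; apply: component_eq.
  by case: x y d => x hx [y hy] d; exact: core_gconn d.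
- move=> _ [g /(theta_surj ch p q locB locC)[x [cx xE]] <-].
  exists (component (exist _ x cx : core D)); first by exists (exist _ x cx).
  by rewrite ThetaE.
Qed.
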